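(* Let $p\ge 17$ be prime, $k\ge 1$, $A,B\in\mathbb{N}$, $\bar A=A\bmod p$, $\bar B=B\bmod p$, and assume $4\bar A^3+27\bar B^2\not\equiv 0\pmod p$. Let $N_k$ be the number of pairs $(x,y)\in\mathbb{F}_{p^k}^2$ with $y^2=x^3+\bar Ax+\bar B$. Put \[ r=\left(\left\lfloor\frac{\left(2^{3p^2}+\bar A\,2^{p^2}+\bar B\right)^{\lfloor p/2\rfloor}}{2^{p^2(p-1)}}\right\rfloor\bmod 2^{p^2}\right)\bmod p,\qquad i=1\mathbin{\dot{-}}\bigl((4p+1)\mathbin{\dot{-}}r^2\bigr), \] \[ a^+=r(1\mathbin{\dot{-}}i),\qquad a^-=i(p\mathbin{\dot{-}}r),\qquad W=(k+1)\,p,\qquad u=2^W, \] \[ P^+=4u^2+3a^-u+p(a^++2),\qquad P^-=(3a^++2p)u+pa^-, \] \[ \widetilde P=P^+\mathbin{\dot{-}}P^-,\qquad \widetilde Q=\bigl((u^2+a^-u+p)\mathbin{\dot{-}}a^+u\bigr)(u\mathbin{\dot{-}}p),\qquad F=\left\lfloor\frac{u^{\,k+1}\,\widetilde P}{\widetilde Q}\right\rfloor . \] Then \[ N_k=3p^k\mathbin{\dot{-}}\bigl(F\bmod u\bigr). \] In particular, the right-hand side is an arithmetic term over the natural numbers (in $A,B,p,k$), with no signed intermediate quantities.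
   Context: $\mathbb{N}$ includes $0$. Truncated subtraction is $x\mathbin{\dot{-}}y=\max(x-y,0)$; $a\bmod b$ is the least nonnegative residue. An arithmetic term is a fixed finite composition of addition, truncated subtraction, multiplication, integer division $\lfloor x/y\rfloor$ (with positive denominators) and exponentiation on natural numbers, with $0^0=1$; the remainder $x\bmod y=x\mathbin{\dot{-}}y\lfloor x/y\rfloor$ is then also an arithmetic term. The numbers satisfy $p-N_1=r-pi=a^+-a^-$ (the trace of Frobenius). *)

(* Defs.v *)
From mathcomp Require Import all_boot all_algebra.

Set Implicit Arguments.
Unset Strict Implicit.
Unset Printing Implicit Defensive.

Inductive aterm (n : nat) : Type :=
  | AVar of 'I_n
  | AConst of nat
  | AAdd of aterm n & aterm n
  | ASub of aterm n & aterm n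
  | AMul of aterm n & aterm n
  | ADiv of aterm n & aterm n
  | AExp of aterm n & aterm n.

(* [None] means that some division in the term has denominator 0; all
   intermediate values are natural numbers, with truncated subtraction and
   0 ^ 0 = 1. *)
Fixpoint aeval (n : nat) (env : n.-tuple nat) (t : aterm n) : option nat :=
  let lift2 (op : nat -> nat -> nat) (ox oy : option nat) :=
    if ox is Some x then if oy is Some y then Some (op x y) else None
    else None in
  match t with
  | AVar i => Some (tnth env i)
  | AConst c => Some c
  | AAdd t1 t2 => lift2 addn (aeval env t1) (aeval env t2)
  | ASub t1 t2 => lift2 subn (aeval env t1) (aeval env t2)
  | AMul t1 t2 => lift2 muln (aeval env t1) (aeval env t2)
  | ADiv t1 t2 =>
      if aeval env t2 is Some y then
        if 0 < y then lift2 divn (aeval env t1) (Some y) else None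
      else None
  | AExp t1 t2 => lift2 expn (aeval env t1) (aeval env t2)
  end.

Definition affine_points (K : finFieldType) (a b : K) : {set K * K} :=
  [set xy : K * K | xy.2 ^+ 2 == xy.1 ^+ 3 + a * xy.1 + b]%R.

(* Everything is computed in [nat]: every [-] below is truncated. *)
Definition count_formula (A B p k : nat) : nat :=
  let a := A %% p in
  let b := B %% p in
  let X := 2 ^ (p ^ 2) in
  let r := (((2 ^ (3 * p ^ 2) + a * X + b) ^ (p %/ 2)
               %/ 2 ^ (p ^ 2 * (p - 1))) %% X) %% p in
  let i := 1 - ((4 * p + 1) - r ^ 2) in
  let ap := r * (1 - i) in
  let am := i * (p - r) in
  let W := (k + 1) * p in
  let u := 2 ^ W in
  let Pp := 4 * u ^ 2 + 3 * am * u + p * (ap + 2) in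
  let Pm := (3 * ap + 2 * p) * u + p * am in
  let P := Pp - Pm in
  let Q := ((u ^ 2 + am * u + p) - ap * u) * (u - p) in
  let F := (u ^ (k + 1) * P) %/ Q in
  3 * p ^ k - F %% u.

(* Main.v *)
Require Import Defs.
From HB Require Import structures.
From mathcomp Require Import all_boot all_order all_algebra all_field.
From mathcomp Require Import zify ring.

(* Let chi be the quadratic character of F_q, f = X^3 + aX + b, and for g monic let
   omega(g) = chi(Res(g, f)), where the resultant is computed as a determinant
   det g(C), with C a companion matrix of f.  The L-function
   L(T) = sum_g omega(g) T^(deg g) over the monic polynomials is a polynomial of
   degree 2: for deg g >= 3, g is equidistributed modulo f and omega averages to 0.
   Its linear coefficient is c = sum_x chi(f(x)), and its quadratic coefficient is q,
   by counting the pairs (g, v) with deg g = 2, deg v <= 1 and g | f - v^2.  Newton's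
   identities, read off the Euler product, then express the character sum over F_(q^k)
   as minus the k-th power sum of the roots of X^2 + cX + q.
   For Hasse's bound c^2 <= 4q, Bombieri's version of Stepanov's method gives
   sum_x chi(f(x)) >= -4s - 2 over a field with s^2 elements; if c^2 > 4q, the power
   sums would grow faster than that along the fields with q^(2j) elements.
   Euler's criterion gives c modulo p as a coefficient of f^((p-1)/2), and Hasse's
   bound determines c from its residue.  Finally F is the integral part of a truncation
   of the generating series of 2p^j + s_j at 1/u, whose last base-u digit is
   2p^k + s_k. *)

Set Implicit Arguments.
Unset Strict Implicit.
Unset Printing Implicit Defensive.
Import Order.TTheory GRing.Theory Num.Theory.

(** * The quadratic character of a finite field *)

Section QuadraticCharacter.

Local Open Scope ring_scope.

(** Euler's criterion serves as the definition, so multiplicativity can be checked on powers in [F];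
    the link with square roots is [card_sqrt]. *)
Definition qchar (F : finFieldType) (z : F) : int :=
  if z == 0 then 0 else if z ^+ (#|F|.-1)./2 == 1 then 1 else -1.

Variable F : finFieldType.
Hypothesis oddF : odd #|F|.
Local Notation h := ((#|F|.-1)./2).

Lemma card_gt2 : (2 < #|F|)%N.
Proof.
have := finNzRing_gt1 F; move: oddF; case: #|F| => [|[|[|n]]] //.
Qed.

Lemma card_half : #|F| = h.*2.+1.
Proof. have := odd_double_half #|F|; have := card_gt2; rewrite oddF; lia. Qed.

Lemma card_half_gt0 : (0 < h)%N.
Proof. have := card_gt2; have := card_half; lia. Qed.

Lemma two_neq0 : (2%:R : F) != 0.
Proof.
apply/negP => h2; have F2 : (2%N \in [pchar F]) by rewrite !inE h2.
move: oddF; have := card_gt2; rewrite (card_pprimeChar F2).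
by case: (logn _ _) => // n _; rewrite expnS oddM.
Qed.

Lemma expf_half_sqr (z : F) : z != 0 -> z ^+ h ^+ 2 = 1.
Proof.
move=> z0; apply: (mulfI z0); rewrite -exprM -exprS mulr1 muln2 -card_half.
exact: expf_card.
Qed.

Lemma qchar0 : qchar (0 : F) = 0.
Proof. by rewrite /qchar eqxx. Qed.

Lemma qchar_eq0 (z : F) : (qchar z == 0) = (z == 0).
Proof. by rewrite /qchar; case: ifP => // _; case: ifP. Qed.

Lemma qchar1 : qchar (1 : F) = 1.
Proof. by rewrite /qchar oner_eq0 expr1n eqxx. Qed.

Lemma qchar_cases (z : F) : [|| qchar z == 0, qchar z == 1 | qchar z == -1].
Proof. by rewrite /qchar; case: ifP => // _; case: ifP. Qed.

Lemma qcharE (z : F) : (qchar z)%:~R = z ^+ h :> F.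
Proof.
rewrite /qchar; case: eqP => [->|/eqP z0].
  by rewrite expr0n; case: h card_half_gt0.
case: eqP => [->//|/eqP zn1]; apply/esym/eqP.
have := expf_half_sqr z0 => /eqP; rewrite sqrf_eq1 (negbTE zn1) /=.
by rewrite rmorphN1.
Qed.

(** In odd characteristic -1, 0 and 1 stay distinct in [F], so identities between character values
    can be verified there. *)
Lemma qchar_inj (x y : int) : [|| x == 0, x == 1 | x == -1] ->
  [|| y == 0, y == 1 | y == -1] -> (x%:~R : F) = y%:~R -> x = y.
Proof.
have n1 : (1 : F) != 0 := oner_neq0 F.
have n2 : (1 : F) == -1 = false.
  by apply/negP; rewrite -subr_eq0 opprK; have := two_neq0; rewrite mulr2n => /negbTE ->.
case/or3P => /eqP -> /or3P [] /eqP -> //; rewrite ?rmorph0 ?rmorph1 ?rmorphN1 => /eqP;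
by rewrite ?[_ == 0]eq_sym ?[0 == _]eq_sym ?[-1 == 1]eq_sym ?oppr_eq0 ?n2 ?(negbTE n1).
Qed.

Lemma qcharP (z : F) (x : int) : [|| x == 0, x == 1 | x == -1] ->
  z ^+ h = x%:~R :> F -> qchar z = x.
Proof.
by move=> hx hz; apply: qchar_inj (qchar_cases z) hx _; rewrite qcharE.
Qed.

Lemma qcharM : {morph @qchar F : x y / x * y}.
Proof.
move=> x y; apply: qcharP; last by rewrite intrM !qcharE exprMn.
by case/or3P: (qchar_cases x) (qchar_cases y) => /eqP -> /or3P [] /eqP ->.
Qed.

Lemma qcharX (z : F) n : qchar (z ^+ n) = qchar z ^+ n.
Proof. by elim: n => [|n IH]; rewrite ?qchar1 // !exprS qcharM IH. Qed.

Lemma qchar_sqr (z : F) : z != 0 -> qchar (z ^+ 2) = 1.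
Proof.
move=> z0; apply: qcharP => //; rewrite -exprM mulnC exprM.
exact: expf_half_sqr.
Qed.

Lemma card_sqrt_sqr (z : F) : #|[set y | y ^+ 2 == z ^+ 2]| = if z == 0 then 1%N else 2%N.
Proof.
have -> : [set y | y ^+ 2 == z ^+ 2] = [set z; - z].
  by apply/setP => y; rewrite !inE eqf_sqr.
rewrite cards2; case: (eqVneq z 0) => [->|z0]; first by rewrite oppr0 eqxx.
by rewrite -subr_eq0 opprK -mulr2n -mulr_natr mulf_eq0 (negbTE two_neq0) (negbTE z0).
Qed.

(* The nonzero squares are the image of a 2-to-1 map, and they are roots of
   X^h - 1, which leaves no room for other roots. *)
Lemma card_sqrt (z : F) : #|[set y : F | y ^+ 2 == z]|%:Z = 1 + qchar z.
Proof.
case: (set_0Vmem [set y : F | y ^+ 2 == z]) => [E|[y]]; last first.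
  rewrite inE => /eqP <-; rewrite card_sqrt_sqr.
  by case: eqP => [->|/eqP y0]; rewrite ?expr0n ?qchar0 ?qchar_sqr.
pose Q := [set w : F | [exists y, (y != 0) && (y ^+ 2 == w)]].
have z0 : z != 0.
  by apply/negP=> /eqP z0; move/setP: E => /(_ 0); rewrite !inE z0 expr0n eqxx.
have cQ : (#|Q| * 2 = h.*2)%N.
  have -> : h.*2 = #|[set~ (0 : F)]| by rewrite cardsC1 [in RHS]card_half.
  rewrite -sum_nat_const -[RHS]sum1_card [RHS](partition_big (fun y => y ^+ 2) (mem Q)) /=.
    apply: eq_bigr => w; rewrite inE => /existsP [y /andP [y0 /eqP <-]].
    rewrite -[LHS]/(if false then 1%N else 2%N) -(negbTE y0) -card_sqrt_sqr -sum1_card.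
    apply: eq_bigl => x; rewrite !inE; case: (eqVneq x 0) => // ->.
    by rewrite expr0n /= eq_sym expf_eq0 (negbTE y0) andbF.
  by move=> y; rewrite !inE => y0; apply/existsP; exists y; rewrite y0 eqxx.
apply/eqP; rewrite E cards0 eq_sym addr_eq0; apply/eqP.
rewrite /qchar (negbTE z0); case: eqP => // zh; exfalso.
have rts : all (root ('X^h - 1%:P)) (z :: enum Q).
  rewrite /= rootE !hornerE zh subrr eqxx /=; apply/allP => w; rewrite mem_enum inE.
  case/existsP => y /andP [y0 /eqP <-].
  by rewrite rootE !hornerE -exprM mulnC exprM expf_half_sqr ?subrr.
have un : uniq (z :: enum Q).
  rewrite /= enum_uniq andbT mem_enum inE; apply/negP => /existsP [y /andP [_ y2]].
  by move/setP: E => /(_ y); rewrite !inE y2.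
have := max_poly_roots _ rts un; rewrite size_XnsubC ?card_half_gt0 //= -cardE.
rewrite monic_neq0 ?monicXnsubC ?card_half_gt0 // => /(_ isT).
by move/eqP: cQ; rewrite -muln2 eqn_pmul2r // => /eqP ->; rewrite ltnn.
Qed.

(** Each [y] is a square root of exactly one [z], so the root counts [1 + qchar z] add up to
    [#|F|]. *)
Lemma sum_qchar : \sum_(z : F) qchar z = 0.
Proof.
have /eqP : \sum_(z : F) (1 + qchar z) = #|F|%:Z.
  rewrite -(eq_bigr _ (fun z _ => card_sqrt z)) -(big_morph Posz PoszD (erefl (Posz 0))).
  rewrite -[in RHS]sum1_card [in RHS](partition_big (fun y : F => y ^+ 2) predT) //=.
  congr (_%:Z); apply: eq_bigr => z _; rewrite -sum1_card.
  by apply: eq_bigl => y; rewrite inE.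
rewrite big_split /= sumr_const natz -subr_eq0 addrAC subrr add0r.
by move/eqP.
Qed.

Lemma exists_nonsquare : exists n : F, qchar n = -1.
Proof.
have [n /eqP hn|no] := pickP (fun n : F => qchar n == -1); first by exists n.
suff : (0 < \sum_(z : F) qchar z) by rewrite sum_qchar.
rewrite (bigD1 1) //= qchar1 ltr_pwDl // sumr_ge0 // => z _.
by have := no z; case/or3P: (qchar_cases z) => /eqP ->.
Qed.

End QuadraticCharacter.

(** * The resultant with a cubic *)

Section Cubic.

Local Open Scope ring_scope.
Variable F : fieldType.

Definition cubic (a b : F) : {poly F} := 'X^3 + a *: 'X + b%:P.

Lemma horner_cubic a b x : (cubic a b).[x] = x ^+ 3 + a * x + b.
Proof. by rewrite !hornerE. Qed.

Lemma size_cubic a b : size (cubic a b) = 4.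
Proof.
rewrite /cubic -addrA size_polyDl size_polyXn // (leq_ltn_trans (size_polyD _ _)) //.
rewrite gtn_max (leq_ltn_trans (size_scale_leq _ _)) ?size_polyX //.
by rewrite (leq_ltn_trans (size_polyC_leq1 _)).
Qed.

Lemma monic_cubic a b : cubic a b \is monic.
Proof.
rewrite monicE lead_coefE size_cubic /cubic !coefE /=; apply/eqP; ring.
Qed.

Lemma det_mx33 (A : 'M[F]_3) (B := fun m n => A (inord m) (inord n)) :
  \det A = B 0%N 0%N * (B 1%N 1%N * B 2%N 2%N - B 1%N 2%N * B 2%N 1%N)
         - B 0%N 1%N * (B 1%N 0%N * B 2%N 2%N - B 1%N 2%N * B 2%N 0%N)
         + B 0%N 2%N * (B 1%N 0%N * B 2%N 1%N - B 1%N 1%N * B 2%N 0%N).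
Proof.
have AE i j : A i j = B i j by rewrite /B !inord_val.
rewrite (expand_det_row _ ord0) !big_ord_recl big_ord0 /cofactor.
rewrite !(expand_det_row _ ord0) !big_ord_recl !big_ord0 /cofactor !det_mx11 !mxE.
rewrite !AE /= /bump /= ?addn0 ?expr0 ?expr1 ?expr2; ring.
Qed.

Definition cubicC (a b : F) : 'M[F]_3 :=
  \matrix_(i, j) nth 0 (nth [::] [:: [:: 0; 1; 0]; [:: 0; 0; 1]; [:: - b; - a; 0]] i) j.

(* The determinant of g(C), C a companion matrix of the cubic, is the product
   of the values of g at the roots of the cubic. *)
Definition cnorm (a b : F) (g : {poly F}) : F := \det (horner_mx (cubicC a b) g).

Variables a b : F.
Local Notation C := (cubicC a b).
Local Notation N := (cnorm a b).

Lemma cnormM : {morph N : g h / g * h}.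
Proof. by move=> g h; rewrite /cnorm rmorphM /= -det_mulmx. Qed.

Lemma cnorm1 : N 1 = 1.
Proof. by rewrite /cnorm rmorph1 det1. Qed.

Lemma cnormC c : N c%:P = c ^+ 3.
Proof. by rewrite /cnorm horner_mx_C det_scalar. Qed.

Lemma cnorm_prod (I : Type) (r : seq I) (P : pred I) (G : I -> {poly F}) :
  N (\prod_(i <- r | P i) G i) = \prod_(i <- r | P i) N (G i).
Proof. exact: (big_morph _ cnormM cnorm1). Qed.

Lemma cnormXsubC e : N ('X - e%:P) = - (cubic a b).[e].
Proof.
rewrite horner_cubic /cnorm rmorphB /= horner_mx_X horner_mx_C det_mx33 !mxE.
rewrite -!val_eqE /= !inordK //=; ring.
Qed.

(** With y = X - t and y^2 = D, the cubic becomes beta + alpha y, where alpha = D + 3t^2 + a and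
    beta = 3tD + f(t); the right-hand side is its norm beta^2 - D alpha^2. *)
Lemma cnorm_quadratic t D : N (('X - t%:P) ^+ 2 - D%:P) =
  (3%:R * t * D + (cubic a b).[t]) ^+ 2 - D * (D + 3%:R * t ^+ 2 + a) ^+ 2.
Proof.
rewrite horner_cubic /cnorm rmorphB rmorphXn rmorphB /= horner_mx_X !horner_mx_C.
rewrite expr2 det_mx33 !mxE !big_ord_recl !big_ord0 !mxE -!val_eqE /= !inordK //=.
ring.
Qed.

Lemma horner_cubicC : horner_mx C (cubic a b) = 0.
Proof.
rewrite /cubic !rmorphD /= rmorphXn /= linearZ /= horner_mx_X horner_mx_C.
apply/matrixP => i j; rewrite exprS expr2 !mxE !big_ord_recl !big_ord0 !mxE.
rewrite !big_ord_recl !big_ord0 !mxE -!val_eqE /=.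
by case: i => [[|[|[|?]]] ?] //; case: j => [[|[|[|?]]] ?] //=; ring.
Qed.

Lemma cnorm_add_mul g h : N (cubic a b * h + g) = N g.
Proof. by rewrite /cnorm rmorphD rmorphM /= horner_cubicC mul0r add0r. Qed.

End Cubic.

Section CubicMap.

Local Open Scope ring_scope.
Variables (F K : fieldType) (iota : {rmorphism F -> K}) (a b : F).

Lemma map_cubic : map_poly iota (cubic a b) = cubic (iota a) (iota b).
Proof. by rewrite /cubic !rmorphD /= map_polyZ map_polyXn map_polyX map_polyC. Qed.

Lemma map_cnorm g : iota (cnorm a b g) = cnorm (iota a) (iota b) (map_poly iota g).
Proof.
rewrite /cnorm -det_map_mx map_horner_mx; congr (\det (horner_mx _ _)).
apply/matrixP => i j; rewrite !mxE.
by case: i => [[|[|[|?]]] ?] //; case: j => [[|[|[|?]]] ?] //=;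
  rewrite ?rmorph0 ?rmorph1 ?rmorphN.
Qed.

End CubicMap.

(** * The degree-two coefficient of the L-polynomial *)

Section QuadraticSqrt.

Local Open Scope ring_scope.
Variable F : finFieldType.
Hypothesis oddF : odd #|F|.

Local Notation two := (two_neq0 oddF).

Lemma qchar_sqrt (z : F) : qchar z != -1 -> exists y, z = y ^+ 2.
Proof.
case: (set_0Vmem [set y : F | y ^+ 2 == z]) => [E|[y]].
  by have := card_sqrt oddF z; rewrite E cards0 => /eqP; rewrite eq_sym addrC addr_eq0 => ->.
by rewrite inE => /eqP <- _; exists y.
Qed.

Lemma card_sum_int (I : finType) (P : {pred I}) : #|P|%:Z = \sum_x (x \in P)%:R.
Proof. by rewrite -sum1_card -natz natr_sum big_mkcond; apply: eq_bigr => x _; case: ifP. Qed.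

Lemma sum_eq_sqr (z : F) : \sum_(y : F) (y ^+ 2 == z)%:R = 1 + qchar z :> int.
Proof.
by rewrite -card_sqrt // card_sum_int; apply: eq_bigr => y _; rewrite inE.
Qed.

Lemma sum_delta (I : finType) (x : I) (G : I -> int) :
  \sum_(y : I) (y == x)%:R * G y = G x.
Proof.
rewrite (bigD1 x) //= eqxx mul1r big1 ?addr0 // => y /negbTE ->.
by rewrite mul0r.
Qed.

(* Square roots of alpha y + beta in F[y]/(y^2 - D), written w + v y. *)
Definition nsqrt2 (D alpha beta : F) : int :=
  \sum_(w : F) \sum_(v : F)
     ((2%:R * v * w == alpha) && (w ^+ 2 + D * v ^+ 2 == beta))%:R.

(** For D = d^2 nonzero the algebra splits as F x F by y = d and y = -d, and roots are extracted in
    each component. *)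
Lemma nsqrt2_split (d alpha beta : F) : d != 0 ->
  nsqrt2 (d ^+ 2) alpha beta =
  (1 + qchar (beta + d * alpha)) * (1 + qchar (beta - d * alpha)).
Proof.
move=> d0; have t0 := two; rewrite /nsqrt2 pair_bigA /=.
rewrite -!sum_eq_sqr big_distrl /=; under [RHS]eq_bigr do rewrite big_distrr /=.
rewrite pair_bigA /=.
rewrite [RHS](reindex (fun p : F * F => (p.1 + d * p.2, p.1 - d * p.2))) /=; last first.
  exists (fun p : F * F => ((p.1 + p.2) / 2%:R, (p.1 - p.2) / (2%:R * d))) => -[x y] _ /=;
  congr (_, _); field; rewrite ?d0 ?t0 //.
apply: eq_bigr => -[w v] _ /=; rewrite -natrM mulnb; congr (nat_of_bool _)%:R.
apply/andP/andP => -[/eqP h1 /eqP h2]; split; apply/eqP.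
- by rewrite -h1 -h2; ring.
- by rewrite -h1 -h2; ring.
- have h : (2%:R * d) * (2%:R * v * w) = (2%:R * d) * alpha.
    have -> : (2%:R * d) * alpha = (beta + d * alpha) - (beta - d * alpha) by ring.
    by rewrite -h1 -h2; ring.
  by apply: mulfI h; rewrite mulf_neq0.
- have h : 2%:R * (w ^+ 2 + d ^+ 2 * v ^+ 2) = 2%:R * beta.
    have -> : 2%:R * beta = (beta + d * alpha) + (beta - d * alpha) by ring.
    by rewrite -h1 -h2; ring.
  exact: mulfI h.
Qed.

(** In the dual numbers a square root of a nonzero constant term lifts uniquely, while a nonzero
    nilpotent has no root. *)
Lemma nsqrt2_double (alpha beta : F) : (beta == 0 -> alpha != 0) ->
  nsqrt2 0 alpha beta = qchar beta ^+ 2 + qchar beta.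
Proof.
move=> hab; have t0 := two; rewrite /nsqrt2.
case: (eqVneq beta 0) hab => [-> /(_ isT) a0 | b0 _].
  rewrite qchar0 big1 // => w _; rewrite big1 // => v _.
  rewrite mul0r addr0 expf_eq0 /=; case: eqP => [h1|]; case: eqP => [h2|] //.
  by move: a0; rewrite -h1 h2 mulr0 eqxx.
have -> : qchar beta ^+ 2 = 1.
  by move: (qchar_cases beta); rewrite qchar_eq0 (negbTE b0) /= => /orP [] /eqP ->.
rewrite -sum_eq_sqr; apply: eq_bigr => w _; rewrite -[LHS](mulr1 _).
case: (eqVneq (w ^+ 2) beta) => [hw|hw]; last first.
  by rewrite big1 ?mul0r // => v _; rewrite mul0r addr0 (negbTE hw) andbF.
have w0 : w != 0 by apply: contraNneq b0 => w0; rewrite -hw w0 expr0n.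
rewrite mulr1 -[RHS](sum_delta (alpha / (2%:R * w)) (fun=> 1)).
apply: eq_bigr => v _; rewrite mul0r addr0 hw eqxx andbT mulr1.
congr (nat_of_bool _)%:R; apply/eqP/eqP => [<-|->]; field; rewrite ?w0 ?t0 //.
Qed.

Section Inert.

Variable D : F.
Hypothesis nsqD : qchar D = -1.

Lemma norm_eq0 (x y : F) : x ^+ 2 = D * y ^+ 2 -> x = 0 /\ y = 0.
Proof.
have [->|y0] := eqVneq y 0.
  by rewrite expr0n mulr0 => /eqP; rewrite expf_eq0 /= => /eqP ->.
move=> h; have hD : D = (x / y) ^+ 2 by rewrite expr_div_n h mulfK // expf_neq0.
move: nsqD; rewrite hD; case: (eqVneq (x / y) 0) => [->|nz].
  by rewrite expr0n qchar0.
by rewrite qchar_sqr.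
Qed.

Lemma nsqrt2_inert_sol (w0 v0 : F) :
  nsqrt2 D (2%:R * v0 * w0) (w0 ^+ 2 + D * v0 ^+ 2) =
  1 + qchar ((w0 ^+ 2 - D * v0 ^+ 2) ^+ 2).
Proof.
have t0 := two; rewrite /nsqrt2 pair_bigA /=.
have E (p : F * F) : ((2%:R * p.2 * p.1 == 2%:R * v0 * w0) &&
    (p.1 ^+ 2 + D * p.2 ^+ 2 == w0 ^+ 2 + D * v0 ^+ 2)) = (p \in [set (w0, v0); (- w0, - v0)]).
  case: p => w v; rewrite !inE !xpair_eqE /=; apply/andP/orP; last first.
    by case=> /andP [/eqP -> /eqP ->]; split; apply/eqP; ring.
  case=> /eqP h1 /eqP h2.
  (* The norms of s - s0 and s + s0 multiply to the norm of s^2 - s0^2 = 0, where s = w + v y; one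
     of them vanishes. *)
  have : ((w - w0) ^+ 2 - D * (v - v0) ^+ 2) * ((w + w0) ^+ 2 - D * (v + v0) ^+ 2) = 0.
    have -> : ((w - w0) ^+ 2 - D * (v - v0) ^+ 2) * ((w + w0) ^+ 2 - D * (v + v0) ^+ 2) =
      ((w ^+ 2 + D * v ^+ 2) - (w0 ^+ 2 + D * v0 ^+ 2)) ^+ 2
      - D * (2%:R * v * w - 2%:R * v0 * w0) ^+ 2 by ring.
    by rewrite h1 h2; ring.
  move/eqP; rewrite mulf_eq0 !subr_eq0 => /orP [] /eqP /norm_eq0 [] /eqP e1 /eqP e2.
    by left; rewrite -(subr_eq0 w) -(subr_eq0 v) e1 e2.
  by right; rewrite -(subr_eq0 w) -(subr_eq0 v) !opprK e1 e2.
under eq_bigr do rewrite E.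
rewrite -[LHS](_ : (#|[set (w0, v0); (- w0, - v0)]|)%:Z = _); last first.
  exact: card_sum_int.
have eqN (x : F) : (x == - x) = (x == 0).
  by rewrite -subr_eq0 opprK -mulr2n -mulr_natr mulf_eq0 (negbTE t0) orbF.
rewrite cards2 xpair_eqE !eqN.
case: (eqVneq (w0 ^+ 2 - D * v0 ^+ 2) 0) => [z0|nz].
  have /norm_eq0 [-> ->] : w0 ^+ 2 = D * v0 ^+ 2 by apply/eqP; rewrite -subr_eq0 z0.
  by rewrite eqxx expr0n mulr0 subr0 expr0n qchar0.
rewrite qchar_sqr //; case: (eqVneq w0 0) nz => [->|//]; case: (eqVneq v0 0) => [->|//].
by rewrite !expr0n mulr0 subr0 eqxx.
Qed.

(** Here F[y]/(y^2 - D) is a field, and an element is a square exactly when its norm is a square in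
    [F]. *)
Lemma nsqrt2_inert (alpha beta : F) :
  nsqrt2 D alpha beta = 1 + qchar (beta ^+ 2 - D * alpha ^+ 2).
Proof.
have t0 := two.
have four0 : (4%:R : F) != 0 by rewrite (natrM F 2 2) mulf_neq0.
have D0 : D != 0 by rewrite -qchar_eq0 nsqD.
have [[w0 v0] /= /andP [/eqP h1 /eqP h2]|no] := pickP (fun p : F * F =>
   (2%:R * p.2 * p.1 == alpha) && (p.1 ^+ 2 + D * p.2 ^+ 2 == beta)).
  rewrite -h1 -h2 nsqrt2_inert_sol; congr (1 + qchar _); ring.
rewrite /nsqrt2 pair_bigA big1 /=; last by move=> p _; rewrite no.
apply/eqP; rewrite eq_sym addrC addr_eq0; apply/eqP/eqP.
case: (eqVneq (qchar (beta ^+ 2 - D * alpha ^+ 2)) (-1)) => // /qchar_sqrt [r hr].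
exfalso.
have mixed (x y : F) : qchar x * qchar y = -1 -> (exists z, x = z ^+ 2) \/ (exists z, y = z ^+ 2).
  case: (eqVneq (qchar x) (-1)) => [->|/qchar_sqrt ? _]; last by left.
  case: (eqVneq (qchar y) (-1)) => [->//|/qchar_sqrt ? _]; last by right.
have noP w v : 2%:R * v * w = alpha -> w ^+ 2 + D * v ^+ 2 = beta -> False.
  by move=> e1 e2; have := no (w, v); rewrite /= e1 e2 !eqxx.
have [a0|a0] := eqVneq alpha 0.
  have [b0|b0] := eqVneq beta 0.
    by apply: (noP 0 0); rewrite ?a0 ?b0; ring.
  have /mixed : qchar beta * qchar (beta / D) = -1.
    rewrite -(qcharM oddF).
    have -> : beta * (beta / D) = (beta / D) ^+ 2 * D by field.
    by rewrite (qcharM oddF) nsqD qchar_sqr // mulf_neq0 // invr_eq0.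
  case=> -[z hz].
    by apply: (noP z 0); rewrite ?a0 ?hz; ring.
  apply: (noP 0 z); first by rewrite a0; ring.
  rewrite -hz; field; exact: D0.
(* If w + v y squares to beta + alpha y, then w^2 is (beta + r)/2 or (beta - r)/2. Their product is
   D times a nonzero square, so one of them is a square. *)
have /mixed : qchar ((beta + r) / 2%:R) * qchar ((beta - r) / 2%:R) = -1.
  rewrite -(qcharM oddF).
  have -> : (beta + r) / 2%:R * ((beta - r) / 2%:R) = (alpha / 2%:R) ^+ 2 * D.
    have -> : (beta + r) / 2%:R * ((beta - r) / 2%:R) = (beta ^+ 2 - r ^+ 2) / (2%:R * 2%:R).
      by field; rewrite four0 ?t0.
    by rewrite -hr; field; rewrite ?four0 ?t0.
  rewrite (qcharM oddF) nsqD qchar_sqr ?mul1r //.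
  by rewrite mulf_neq0 // invr_eq0.
have sol (s z : F) : s ^+ 2 = r ^+ 2 -> (beta + s) / 2%:R = z ^+ 2 -> False.
  move=> hs hz.
  have hz2 : 2%:R * z ^+ 2 = beta + s by rewrite -hz; field.
  have pr : (beta + s) * (beta - s) = D * alpha ^+ 2.
    have -> : (beta + s) * (beta - s) = beta ^+ 2 - s ^+ 2 by ring.
    by rewrite hs -hr; ring.
  have z0 : z != 0.
    apply: contraNneq a0 => z0; move: pr; rewrite -hz2 z0 expr0n !mulr0 mul0r.
    by move/esym/eqP; rewrite mulf_eq0 (negbTE D0) expf_eq0.
  apply: (noP z (alpha / (2%:R * z))); first by field; rewrite ?z0 ?t0 ?four0.
  have -> : z ^+ 2 + D * (alpha / (2%:R * z)) ^+ 2 =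
      z ^+ 2 + (D * alpha ^+ 2) / (2%:R * (2%:R * z ^+ 2)) by field; rewrite ?z0 ?t0 ?four0.
  rewrite -pr -hz2 [in RHS](_ : beta = (2%:R * z ^+ 2 + (beta - s)) / 2%:R).
    by field; rewrite ?z0 ?t0 ?four0.
  by rewrite hz2; field.
case=> -[z hz]; first exact: sol hz.
by apply: (sol (- r) z) => //; rewrite sqrrN.
Qed.

End Inert.

End QuadraticSqrt.

Section QuadraticSum.

Local Open Scope ring_scope.
Variable F : finFieldType.
Hypothesis oddF : odd #|F|.
Variables a b : F.
Local Notation f := (cubic a b).
Hypothesis sqfree : forall x, f.[x] = 0 -> 3%:R * x ^+ 2 + a != 0.

Let alpha (t D : F) := D + 3%:R * t ^+ 2 + a.
Let beta (t D : F) := 3%:R * t * D + f.[t].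

(** One formula for the three types of algebra: the sum over d is empty for a nonsquare D, has two
    terms for a nonzero square, and one for D = 0, where [sqfree] excludes alpha = beta = 0. *)
Lemma nsqrt2_cubic t D :
  nsqrt2 D (alpha t D) (beta t D) =
  1 + qchar (cnorm a b (('X - t%:P) ^+ 2 - D%:P)) - (D == 0)%:R
  + \sum_(d : F) (d ^+ 2 == D)%:R * qchar f.[t + d].
Proof.
rewrite cnorm_quadratic -/(alpha t D) -/(beta t D).
have t0 := two_neq0 oddF.
have [D0|D0] := eqVneq D 0.
  have -> : beta t D = f.[t] by rewrite /beta D0; ring.
  rewrite D0 mul0r subr0 nsqrt2_double //; last first.
    by move=> /eqP /sqfree; rewrite /alpha add0r.
  rewrite (qcharX oddF) (bigD1 0) //= expr0n eqxx mul1r addr0 big1 ?addr0; first by ring.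
  by move=> d; rewrite expf_eq0 /= => /negbTE ->; rewrite mul0r.
rewrite subr0; have [nsq|/(qchar_sqrt oddF) [d hd]] := eqVneq (qchar D) (-1).
  rewrite nsqrt2_inert // big1 ?addr0 // => d _.
  case: eqP => [hd|]; last by rewrite mul0r.
  by move/eqP: nsq; rewrite -hd; case: (eqVneq d 0) => [->|d0];
    rewrite ?expr0n ?qchar0 ?qchar_sqr.
have d0 : d != 0 by apply: contraNneq D0 => d0; rewrite hd d0 expr0n.
have dn : d != - d by rewrite -subr_eq0 opprK -mulr2n -mulr_natr mulf_neq0.
rewrite hd nsqrt2_split // (bigD1 d) //= (bigD1 (- d)) 1?eq_sym //= sqrrN eqxx !mul1r.
rewrite big1 ?addr0; last first.
  by move=> e /andP [/negbTE e1 /negbTE e2]; rewrite eqf_sqr e1 e2 mul0r.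
have e1 : beta t (d ^+ 2) + d * alpha t (d ^+ 2) = f.[t + d].
  by rewrite /beta /alpha !horner_cubic; ring.
have e2 : beta t (d ^+ 2) - d * alpha t (d ^+ 2) = f.[t - d].
  by rewrite /beta /alpha !horner_cubic; ring.
rewrite e1 e2.
have -> : beta t (d ^+ 2) ^+ 2 - d ^+ 2 * alpha t (d ^+ 2) ^+ 2 = f.[t + d] * f.[t - d].
  by rewrite -e1 -e2; ring.
rewrite (qcharM oddF); ring.
Qed.

Lemma sum_nsqrt2_cubic : \sum_t \sum_D nsqrt2 D (alpha t D) (beta t D) =
  #|F|%:R * \sum_(x : F) (1 + qchar f.[x]).
Proof.
have t0 := two_neq0 oddF.
under eq_bigr => t _.
  rewrite exchange_big; under eq_bigr => w _.
    rewrite exchange_big; under eq_bigr => v _.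
      (* The first equation determines D. The second becomes f(e) = l(e)^2 for the line l = w + v (X
         - t), where e = v^2 - 2t is the third root of f - l^2. *)
      have -> : \sum_D ((2%:R * v * w == alpha t D) && (w ^+ 2 + D * v ^+ 2 == beta t D))%:R =
          (f.[v ^+ 2 - 2%:R * t] == (w + v * (v ^+ 2 - 3%:R * t)) ^+ 2)%:R :> int.
        rewrite -(sum_delta (2%:R * v * w - 3%:R * t ^+ 2 - a)
          (fun=> (f.[v ^+ 2 - 2%:R * t] == (w + v * (v ^+ 2 - 3%:R * t)) ^+ 2)%:R)).
        apply: eq_bigr => D _; rewrite -natrM mulnb; congr (nat_of_bool _)%:R.
        have -> : (2%:R * v * w == alpha t D) = (D == 2%:R * v * w - 3%:R * t ^+ 2 - a).
          by apply/eqP/eqP => [h|->]; rewrite ?h /alpha; ring.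
        case: eqP => //= ->; rewrite -subr_eq0 -[in RHS]subr_eq0 -oppr_eq0.
        congr (_ == 0); rewrite /beta !horner_cubic; ring.
      over.
    over.
  rewrite exchange_big; under eq_bigr => v _.
    have -> : \sum_w (f.[v ^+ 2 - 2%:R * t] == (w + v * (v ^+ 2 - 3%:R * t)) ^+ 2)%:R =
        1 + qchar f.[v ^+ 2 - 2%:R * t].
      rewrite -sum_eq_sqr // [RHS](reindex_inj (addIr (v * (v ^+ 2 - 3%:R * t)))) /=.
      by apply: eq_bigr => w _; rewrite eq_sym.
    over.
  over.
rewrite exchange_big /=.
have E v : \sum_(t : F) (1 + qchar f.[v ^+ 2 - 2%:R * t]) = \sum_x (1 + qchar f.[x]).
  rewrite [RHS](reindex (fun t => v ^+ 2 - 2%:R * t)) //=.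
  by exists (fun x => (v ^+ 2 - x) / 2%:R) => x _ /=; field.
by under eq_bigr do rewrite E; rewrite sumr_const mulr_natl.
Qed.

(* Counting in two ways the pairs (g, v), with g monic quadratic and v of degree
   at most one, such that g divides f - v^2: the quotient is linear, with root e
   satisfying v(e)^2 = f(e). *)
Lemma sum_qchar_quadratic :
  \sum_(t : F) \sum_(D : F) qchar (cnorm a b (('X - t%:P) ^+ 2 - D%:P)) = #|F|%:R.
Proof.
have := sum_nsqrt2_cubic.
under eq_bigr do under eq_bigr do rewrite nsqrt2_cubic.
under eq_bigr do rewrite !big_split /= sumr_const sumrN.
under eq_bigr => t _.
  rewrite [X in _ - X](_ : _ = 1); last first.
    by rewrite -[RHS](sum_delta (0 : F) (fun=> 1)); apply: eq_bigr => D _; rewrite mulr1.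
  rewrite [X in _ + X](_ : _ = \sum_d qchar f.[t + d]); last first.
    rewrite exchange_big; apply: eq_bigr => d _.
    rewrite -[RHS](sum_delta (d ^+ 2) (fun=> qchar f.[t + d])).
    by apply: eq_bigr => D _; rewrite eq_sym.
  have -> : \sum_d qchar f.[t + d] = \sum_d qchar f.[d].
    by rewrite [RHS](reindex_inj (addrI t)).
  over.
rewrite !big_split /= !sumr_const.
have -> : #|(xpredT : pred F)| = #|F| by apply: eq_card.
(* The identity now reads q^2 + T - q + q S = q (q + S), whence T = q. *)
set T := \sum_i \sum_j _; set S := \sum_i _; move: #|F| => q.
rewrite -[q%:R *+ q]mulr_natr -[-1 *+ q]mulr_natr -[S *+ q]mulr_natl => h.
by apply/eqP; rewrite -subr_eq0; apply/eqP; move/eqP: h; rewrite -subr_eq0 => /eqP <-; ring.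
Qed.

End QuadraticSum.

(** * The L-polynomial of the cubic *)

Section MonicPoly.

Local Open Scope ring_scope.
Variable F : fieldType.

(** Encoding a monic polynomial by its lower coefficients gives, for each degree, a finite type to
    sum over. *)
Definition mpol n (v : 'rV[F]_n) : {poly F} := 'X^n + rVpoly v.
Definition vpol n (g : {poly F}) : 'rV[F]_n := poly_rV (g - 'X^n).

Lemma size_rVpoly n (v : 'rV[F]_n) : (size (rVpoly v) <= n)%N.
Proof. exact: size_poly. Qed.

Lemma size_mpol n (v : 'rV[F]_n) : size (mpol v) = n.+1.
Proof. by rewrite size_polyDl size_polyXn // ltnS size_rVpoly. Qed.

Lemma monic_mpol n (v : 'rV[F]_n) : mpol v \is monic.
Proof. by rewrite monicE lead_coefDl ?lead_coefXn // size_polyXn ltnS size_rVpoly. Qed.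

Lemma mpol_neq0 n (v : 'rV[F]_n) : mpol v != 0.
Proof. exact: monic_neq0 (monic_mpol v). Qed.

Lemma mpolK n : cancel (@mpol n) (@vpol n).
Proof. by move=> v; rewrite /vpol /mpol addrC addrA addNr add0r rVpolyK. Qed.

Lemma mpol_inj n : injective (@mpol n).
Proof. exact: can_inj (@mpolK n). Qed.

Lemma vpolK n (g : {poly F}) : g \is monic -> size g = n.+1 -> mpol (vpol n g) = g.
Proof.
move=> gm sg; rewrite /mpol /vpol poly_rV_K; first by rewrite addrC subrK.
apply/leq_sizeP => j; rewrite leq_eqVlt coefB coefXn => /orP [/eqP <-|nj].
  by move: gm; rewrite monicE lead_coefE sg eqxx => /eqP ->; rewrite subrr.
by rewrite gtn_eqF // subr0 nth_default // sg.
Qed.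

Lemma monic_quadratic (t D : F) : ('X - t%:P) ^+ 2 - D%:P \is monic.
Proof.
have s2 : (size (- D%:P) < size (('X - t%:P) ^+ 2))%N.
  by rewrite size_exp_XsubC size_polyN (leq_ltn_trans (size_polyC_leq1 _)).
by rewrite monicE lead_coefDl // -monicE monic_exp // monicXsubC.
Qed.

Lemma size_quadratic (t D : F) : size (('X - t%:P) ^+ 2 - D%:P) = 3.
Proof.
have s2 : (size (- D%:P) < size (('X - t%:P) ^+ 2))%N.
  by rewrite size_exp_XsubC size_polyN (leq_ltn_trans (size_polyC_leq1 _)).
by rewrite size_polyDl // size_exp_XsubC.
Qed.

End MonicPoly.

Section LPolynomial.

Local Open Scope ring_scope.
Variable F : finFieldType.
Hypothesis oddF : odd #|F|.
Variables a b : F.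
Local Notation f := (cubic a b).

(* For g monic the argument of the character is the product of the values of the
   cubic at the roots of g. *)
Definition lchar (g : {poly F}) : int := qchar ((-1) ^+ (size g).-1 * cnorm a b g).

Definition lcoef n : int := \sum_(v : 'rV[F]_n) lchar (mpol v).

Lemma lcharM g h : g != 0 -> h != 0 -> lchar (g * h) = lchar g * lchar h.
Proof.
move=> g0 h0; rewrite /lchar -(qcharM oddF) cnormM size_mul //; congr qchar.
have -> : ((size g + size h).-1.-1 = (size g).-1 + (size h).-1)%N.
  by rewrite -!size_poly_gt0 in g0 h0; lia.
by rewrite exprD; ring.
Qed.

Lemma lchar1 : lchar 1 = 1.
Proof. by rewrite /lchar cnorm1 size_poly1 mulr1 expr0 qchar1. Qed.

Lemma lcharX g n : g != 0 -> lchar (g ^+ n) = lchar g ^+ n.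
Proof.
move=> g0; elim: n => [|n IH]; first exact: lchar1.
by rewrite !exprS lcharM ?IH // expf_neq0.
Qed.

Lemma sum_lchar_dvd (h : {poly F}) j m : h \is monic -> size h = j.+1 ->
  \sum_(v : 'rV[F]_(j + m) | h %| mpol v) lchar (mpol v) = lchar h * lcoef m.
Proof.
move=> hm sh; have h0 := monic_neq0 hm.
have sM (w : 'rV[F]_m) : size (h * mpol w) = (j + m).+1.
  by rewrite size_mul ?mpol_neq0 // sh size_mpol addnS.
have mM (w : 'rV[F]_m) : h * mpol w \is monic by rewrite monicMl ?monic_mpol.
rewrite (reindex_onto (fun w => vpol (j + m) (h * mpol w))
  (fun v => vpol m (mpol v %/ h))) /=; last first.
  move=> v /dvdpP [g hg]; have g0 : g != 0.
    by apply: contraTneq (mpol_neq0 v) => g0; rewrite hg g0 mul0r eqxx.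
  have gm : g \is monic by have := monic_mpol v; rewrite hg monicMr.
  have sg : size g = m.+1.
    by have /eqP := size_mpol v; rewrite hg size_mul // sh addnS /= addnC -addnS eqn_add2l => /eqP.
  by rewrite hg mulpK // vpolK // mulrC -hg mpolK.
rewrite /lcoef big_distrr /= big_mkcond; apply: eq_bigr => w _.
by rewrite vpolK // dvdp_mulr //= mulKp // mpolK eqxx lcharM ?mpol_neq0.
Qed.

Lemma lcoef0 : lcoef 0 = 1.
Proof.
have M1 v : @mpol F 0 v = 1.
  rewrite /mpol (_ : rVpoly v = 0) ?addr0 ?expr0 //.
  by apply/eqP; rewrite -size_poly_leq0 size_rVpoly.
rewrite /lcoef (eq_bigr (fun=> 1)) => [|v _]; last by rewrite M1 lchar1.
by rewrite sumr_const card_mx muln0 expn0.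
Qed.

Lemma lcoef1 : lcoef 1 = \sum_(x : F) qchar f.[x].
Proof.
have hm (x : F) := monicXsubC x.
rewrite /lcoef (reindex (fun x : F => vpol 1 ('X - x%:P))) /=.
  apply: eq_bigr => x _; rewrite vpolK ?size_XsubC // /lchar size_XsubC cnormXsubC.
  by rewrite expr1 mulN1r opprK.
apply/onW_bij/inj_card_bij; last by rewrite card_mx.
move=> x y /(congr1 (@mpol F 1)); rewrite !vpolK ?size_XsubC //.
by move/addrI/oppr_inj/polyC_inj.
Qed.

Lemma lcoef2 : (forall x, f.[x] = 0 -> 3%:R * x ^+ 2 + a != 0) -> lcoef 2 = #|F|%:R.
Proof.
move=> sqf; rewrite -(sum_qchar_quadratic oddF sqf) pair_bigA /=.
have vK (p : F * F) : mpol (vpol 2 (('X - p.1%:P) ^+ 2 - p.2%:P)) = ('X - p.1%:P) ^+ 2 - p.2%:P.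
  by rewrite vpolK ?monic_quadratic ?size_quadratic.
rewrite /lcoef (reindex (fun p : F * F => vpol 2 (('X - p.1%:P) ^+ 2 - p.2%:P))) /=.
  by apply: eq_bigr => p _; rewrite vK /lchar size_quadratic sqrrN expr1n mul1r.
apply/onW_bij/inj_card_bij; last by rewrite card_mx card_prod mul1n expnS expn1.
move=> p p' /(congr1 (@mpol F 2)); rewrite !vK => E.
have t0 := two_neq0 oddF.
(* The values at 0 and 1 recover t, because 2 is invertible, and then D. *)
have H x := congr1 (fun g => g.[x]) E.
have H0 := H 0; have H1 := H 1; rewrite !hornerE in H0 H1.
have e1 : p.1 = p'.1.
  have : 2%:R * (p.1 - p'.1) = ((0 - p.1) ^+ 2 - p.2) - ((1 - p.1) ^+ 2 - p.2)
     - (((0 - p'.1) ^+ 2 - p'.2) - ((1 - p'.1) ^+ 2 - p'.2)) by ring.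
  rewrite !add0r in H0 *; rewrite H0 H1 subrr => /eqP.
  by rewrite mulf_eq0 (negbTE t0) subr_eq0 => /eqP.
move: H0; rewrite e1 => /addrI/oppr_inj e2.
by case: p p' e1 e2 {E H H1} => [? ?] [? ?] /= -> ->.
Qed.

(** Scaling [r] by a nonsquare n multiplies the norm by n^3, of character -1, so the sum equals its
    opposite. *)
Lemma sum_qchar_cnorm c : \sum_(r : 'rV[F]_3) qchar (c * cnorm a b (rVpoly r)) = 0.
Proof.
have [n hn] := exists_nonsquare oddF.
have n0 : n != 0 by rewrite -qchar_eq0 hn.
set S := LHS; suff : S = - S by lia.
rewrite {1}/S (reindex_inj (scalerI n0)) -sumrN; apply: eq_bigr => r _.
rewrite linearZ /= -mul_polyC cnormM cnormC mulrCA (qcharM oddF) (qcharX oddF) hn.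
by rewrite -signr_odd /= expr1 mulN1r.
Qed.

(* Modulo the cubic, the monic polynomials of degree n >= 3 are equidistributed. *)
Lemma lcoef_eq0 n : lcoef n.+3 = 0.
Proof.
pose G (p : 'rV[F]_n * 'rV[F]_3) := f * mpol p.1 + rVpoly p.2.
have sfm (w : 'rV[F]_n) : size (f * mpol w) = n.+4.
  by rewrite size_mul ?mpol_neq0 ?monic_neq0 ?monic_cubic // size_cubic size_mpol.
have sr (r : 'rV[F]_3) : (size (rVpoly r) < 4)%N by rewrite ltnS size_rVpoly.
have lt (w : 'rV[F]_n) (r : 'rV[F]_3) : (size (rVpoly r) < size (f * mpol w)%R)%N.
  by rewrite sfm (leq_trans (sr r)).
have GK p : mpol (vpol n.+3 (G p)) = G p.
  apply: vpolK; rewrite /G; last by rewrite size_polyDl ?lt ?sfm.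
  by rewrite monicE lead_coefDl ?lt // -monicE monicMl ?monic_cubic ?monic_mpol.
rewrite /lcoef (reindex (fun p => vpol n.+3 (G p))) /=.
  under eq_bigr do rewrite GK.
  rewrite -(pair_bigA _ (fun w r => lchar (G (w, r)))) /= big1 // => w _.
  rewrite -[RHS](sum_qchar_cnorm ((-1) ^+ n.+3)); apply: eq_bigr => r _.
  by rewrite /lchar size_polyDl ?lt // sfm cnorm_add_mul.
apply/onW_bij/inj_card_bij; last by rewrite card_prod !card_mx !mul1n -expnD addn3.
move=> p q /(congr1 (@mpol F n.+3)); rewrite !GK /G => E.
have f0 : f != 0 by rewrite monic_neq0 ?monic_cubic.
have e2 : rVpoly p.2 = rVpoly q.2.
  move: (congr1 (fun g : {poly F} => g %% f) E); rewrite !modpD ![f * _]mulrC !modp_mull !add0r.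
  by rewrite !modp_small // size_cubic.
move: E; rewrite e2 => /addIr /(mulfI f0) /mpol_inj e1.
move: (congr1 (@poly_rV F 3) e2); rewrite !rVpolyK.
by case: p q e1 {e2} => [? ?] [? ?] /= -> ->.
Qed.

End LPolynomial.

(** * Newton's identities for the L-polynomial *)

Section Factorization.

Local Open Scope ring_scope.
Variable F : finFieldType.

Lemma irreducible_monic_factor (g : {poly F}) : (1 < size g)%N ->
  exists d (v : 'rV[F]_d), [&& (0 < d)%N, irreducibleb (mpol v) & mpol v %| g].
Proof.
have [n] := ubnP (size g); elim: n => // n IH in g * => sgn sg.
have [gi|gr] := boolP (irreducibleb g); last first.
  move: gr; rewrite /irreducibleb sg negb_forall => /existsP [q].
  rewrite negb_imply -Pdiv.Idomain.dvdpE -ltnNge => /andP [qg sq].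
  have lt : (size q < size g)%N by rewrite (leq_ltn_trans (size_npoly q)) // ltn_predL ltnW.
  have [d [v /and3P [d0 vi vq]]] := IH q (leq_trans lt (ltnSE sgn)) sq.
  by exists d, v; apply/and3P; split; rewrite // (dvdp_trans vq).
have g0 : g != 0 by rewrite -size_poly_gt0 ltnW.
have lg0 : lead_coef g != 0 by rewrite lead_coef_eq0.
pose h := (lead_coef g)^-1 *: g.
have hm : h \is monic by rewrite monicE lead_coefZ mulVf.
have hg : h %= g by rewrite eqp_scale // invr_eq0.
have sh : size h = (size g).-1.+1 by rewrite (eqp_size hg) prednK // ltnW.
exists (size g).-1, (vpol (size g).-1 h); rewrite vpolK // (eqp_dvdl _ hg) dvdpp andbT.
rewrite -ltnS prednK ?(ltnW sg) // sg /=; apply/irreducibleP.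
move/irreducibleP: gi => [_ gi]; split; first by rewrite (eqp_size hg).
by move=> q sq; rewrite (eqp_dvdr _ hg) => /(gi q sq) qg; rewrite (eqp_trans qg) // eqp_sym.
Qed.

Lemma irreducible_monic_coprime (P Q : {poly F}) : P \is monic -> Q \is monic ->
  irreducible_poly P -> irreducible_poly Q -> P != Q -> coprimep P Q.
Proof.
move=> Pm Qm [sP Pi] [sQ Qi] PQ; rewrite /coprimep; apply: contraNT PQ => sg.
have gP := Pi _ sg (dvdp_gcdl _ _); have gQ := Qi _ sg (dvdp_gcdr _ _).
by rewrite -eqp_monic // (eqp_trans _ gQ) // eqp_sym.
Qed.

Lemma irreducibleb_gt0 d (v : 'rV[F]_d) : irreducibleb (mpol v) -> (0 < d)%N.
Proof. by move/irreducibleP => [+ _]; rewrite size_mpol. Qed.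

Definition dvdexp (P : {poly F}) m (g : {poly F}) : bool := P ^+ m %| g.

(** Multiplying by an irreducible raises its own multiplicity by one and leaves the others alone;
    [size g <= N] lets the truncated sums see the full multiplicity. *)
Lemma sum_dvdp_exp N d (v : 'rV[F]_d) d0 (v0 : 'rV[F]_d0) (g : {poly F}) :
  irreducibleb (mpol v) -> irreducibleb (mpol v0) -> g != 0 -> (size g <= N)%N ->
  (\sum_(m < N) dvdexp (mpol v) m.+1 (mpol v0 * g)%R
   = \sum_(m < N) dvdexp (mpol v) m.+1 g + (mpol v == mpol v0))%N.
Proof.
rewrite /dvdexp => vi v0i g0 sg; have d0v := irreducibleb_gt0 vi.
have [e|ne] := eqVneq; last first.
  rewrite addn0; apply: eq_bigr => m _; rewrite Gauss_dvdpr //.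
  by rewrite coprimep_expl // irreducible_monic_coprime ?monic_mpol //; apply/irreducibleP.
case: N sg => [|M sg]; first by rewrite leqNgt size_poly_gt0 g0.
have -> : (\sum_(m < M.+1) dvdexp (mpol v) m.+1 (mpol v0 * g)%R =
           \sum_(m < M.+1) dvdexp (mpol v) m g)%N.
  by apply: eq_bigr => m _; rewrite /dvdexp -e exprS dvdp_mul2l ?mpol_neq0.
(* After the index shift, the term m = 0 gives the extra 1 and the top exponent vanishes because its
   degree exceeds that of [g]. *)
rewrite big_ord_recl {1}/dvdexp expr0 dvd1p addnC; congr (_ + _)%N.
rewrite big_ord_recr /= [X in (_ + X)%N](_ : _ = 0%N) ?addn0 //.
apply/eqP; rewrite eqb0; apply/negP => /(dvdp_leq g0).
rewrite leqNgt => /negP; apply; rewrite (leq_ltn_trans sg) //.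
have := size_exp (mpol v) M.+1; rewrite size_mpol /= => h.
by rewrite -ltnS -(ltn_predK (_ : 0 < size (mpol v ^+ M.+1)%R)%N) ?size_poly_gt0 ?expf_neq0 ?mpol_neq0 //
  ltnS ltnS h leq_pmull.
Qed.

(* The sum over m is the multiplicity of the irreducible factor mpol v in g. *)
Lemma degree_irreducible_factors N n (g : {poly F}) :
  g \is monic -> size g = n.+1 -> (n <= N)%N ->
  (n = \sum_(d < N.+1) \sum_(v : 'rV[F]_d | irreducibleb (mpol v))
        \sum_(m < N) dvdexp (mpol v) m.+1 g * d)%N.
Proof.
elim/ltn_ind: n g => n IH g gm sg nN; rewrite /dvdexp in IH *.
have [n0|n_gt0] := posnP n.
  have g1 : g %| 1 by rewrite dvdp1 sg n0.
  rewrite n0 big1 // => d _; rewrite big1 // => v /irreducibleP [sv _].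
  rewrite big1 // => m _; apply/eqP; rewrite muln_eq0 eqb0; apply/orP; left; apply/negP => h.
  have := dvdp_trans (dvdp_trans (dvdp_exp2l (mpol v) (ltn0Sn m)) h) g1.
  by rewrite expr1 dvdp1; case: eqP sv => // ->.
have [|d0 [v0 /and3P [d0_gt0 v0i /dvdpP [h hg]]]] := @irreducible_monic_factor g.
  by rewrite sg ltnS.
have h0 : h != 0 by apply: contraTneq gm => h0; rewrite hg h0 mul0r monicE lead_coef0 eq_sym oner_eq0.
have hm : h \is monic by move: gm; rewrite hg monicMr ?monic_mpol.
have [k sh] : exists k, size h = k.+1 by exists (size h).-1; rewrite prednK // size_poly_gt0.
have nE : n = (k + d0)%N.
  by have := sg; rewrite hg size_mul ?mpol_neq0 // sh size_mpol addnS => -[<-].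
have lkn : (k < n)%N by rewrite nE -addn1 leq_add2l.
have lkN : (k < N)%N := leq_trans lkn nN.
rewrite [LHS]nE [in LHS](IH k lkn h hm sh (ltnW lkN)).
have E (d : 'I_N.+1) (v : 'rV[F]_d) : irreducibleb (mpol v) ->
  (\sum_(m < N) dvdexp (mpol v) m.+1 g * d = \sum_(m < N) dvdexp (mpol v) m.+1 h * d
    + (mpol v == mpol v0) * d)%N.
  move=> vi; rewrite -!big_distrl /= -mulnDl hg mulrC; congr (_ * _)%N.
  by apply: sum_dvdp_exp; rewrite ?sh.
rewrite [RHS](eq_bigr (fun d : 'I_N.+1 => \sum_(v : 'rV[F]_d | irreducibleb (mpol v))
        \sum_(m < N) dvdexp (mpol v) m.+1 h * d +
        \sum_(v : 'rV[F]_d | irreducibleb (mpol v)) (mpol v == mpol v0) * d)%N); last first.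
  by move=> d _; rewrite -big_split; apply: eq_bigr => v /E.
rewrite big_split /=; congr (_ + _)%N.
have d0N : (d0 < N.+1)%N by rewrite ltnS (leq_trans _ nN) // nE leq_addl.
rewrite (bigD1 (Ordinal d0N)) //= [X in (_ + X)%N]big1 ?addn0; last first.
  move=> d dd0; rewrite big1 // => v _; case: eqP => // /(congr1 (fun g : {poly F} => size g)).
  rewrite !size_mpol => -[e]; case/eqP: dd0; exact/val_inj.
rewrite (bigD1 v0) //= eqxx mul1n big1 ?addn0 // => v /andP [_ vv0].
by rewrite (inj_eq (@mpol_inj _ _)) (negbTE vv0).
Qed.

End Factorization.

Section Newton.

Local Open Scope ring_scope.
Variable F : finFieldType.
Hypothesis oddF : odd #|F|.
Variables a b : F.
Local Notation lchar := (lchar a b).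
Local Notation lcoef := (lcoef a b).
Variable N : nat.

(* The coefficient of T^j in T L'(T)/L(T), computed from the Euler product. *)
Definition psum j : int :=
  \sum_(d < N.+1) \sum_(v : 'rV[F]_d | irreducibleb (mpol v)) \sum_(m < N)
    (d * m.+1 == j)%N%:R * (d%:R * lchar (mpol v) ^+ m.+1).

(** At most one [j] contributes, the degree of the prime power minus one; the sum over [j] prepares
    the exchange with [psum]. *)
Lemma sum_lchar_dvd_exp n d (v : 'rV[F]_d) m : irreducibleb (mpol v) ->
  \sum_(w : 'rV[F]_n | mpol v ^+ m.+1 %| mpol w) lchar (mpol w) =
  \sum_(j < n) (d * m.+1 == j.+1)%N%:R * (lchar (mpol v) ^+ m.+1 * lcoef (n - j.+1)).
Proof.
move=> /irreducibleb_gt0 d0; have v0 := mpol_neq0 v.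
have P0 : mpol v ^+ m.+1 != 0 by rewrite expf_neq0.
have sP : size (mpol v ^+ m.+1) = (d * m.+1).+1.
  by have := size_exp (mpol v) m.+1; rewrite size_mpol /= => <-; rewrite prednK // size_poly_gt0.
have [le|gt] := leqP (d * m.+1) n; last first.
  rewrite big_pred0 ?big1 // => [j _|w].
    by case: eqP => [e|]; rewrite ?mul0r //; move: gt; rewrite e ltnNge ltn_ord.
  apply/negP => /(dvdp_leq (mpol_neq0 w)); rewrite sP size_mpol ltnS leqNgt.
  by rewrite gt.
have [k kE] : exists k, (d * m.+1 = k.+1)%N by exists (d * m.+1).-1; rewrite prednK // muln_gt0 d0.
rewrite kE in sP le *; rewrite (bigD1 (Ordinal le)) //= eqxx mul1r [X in _ + X]big1 ?addr0; last first.
  by move=> j jk; case: eqP => [[e]|]; rewrite ?mul0r //; case/eqP: jk; apply/val_inj.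
move: (subnKC le); set r := (n - k.+1)%N => <-.
have Pm : mpol v ^+ m.+1 \is monic by rewrite monic_exp ?monic_mpol.
by rewrite (sum_lchar_dvd oddF a b r Pm sP) lcharX // addKn.
Qed.

(** This compares coefficients in T L' = L (T L'/L): [n] is split into the degrees of the
    irreducible factors of each monic polynomial, and exchanging sums collects the multiples of each
    prime power. *)
Lemma newton_lcoef n : (n <= N)%N ->
  n%:R * lcoef n = \sum_(j < n) psum j.+1 * lcoef (n - j.+1).
Proof.
move=> nN; rewrite /lcoef big_distrr /=.
under eq_bigr => w _.
  rewrite [X in X%:R](degree_irreducible_factors (monic_mpol w) (size_mpol w) nN).
  rewrite natr_sum; under eq_bigr do rewrite natr_sum; rewrite big_distrl /=.
  under eq_bigr => d _.
    rewrite big_distrl /=; under eq_bigr do rewrite natr_sum big_distrl /=.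
    over.
  over.
rewrite exchange_big /=; under eq_bigr do rewrite exchange_big /=.
under [RHS]eq_bigr do rewrite /psum big_distrl /=.
rewrite [RHS]exchange_big; apply: eq_bigr => d _ /=.
under [RHS]eq_bigr do rewrite big_distrl /=.
rewrite [RHS]exchange_big; apply: eq_bigr => v vi /=.
under [RHS]eq_bigr do rewrite big_distrl /=.
rewrite exchange_big [RHS]exchange_big; apply: eq_bigr => m _ /=.
under [RHS]eq_bigr => j _.
  rewrite (_ : _ * _ = d%:R * ((d * m.+1 == j.+1)%N%:R *
    (lchar (mpol v) ^+ m.+1 * lcoef (n - j.+1)))); last by ring.
  over.
rewrite -big_distrr /= -sum_lchar_dvd_exp // big_distrr [RHS]big_mkcond /=.
by apply: eq_bigr => w _; rewrite /dvdexp; case: ifP; rewrite ?mul1n ?mul0n ?mul0r.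
Qed.

End Newton.

(** * Power sums of the inverse roots of L(T) *)

Section PowerSums.

Local Open Scope ring_scope.

(* The power sums of the roots of X^2 - t X + q. *)
Fixpoint lucas2 (t q : int) n : int * int :=
  if n is n.+1 then let: (x, y) := lucas2 t q n in (y, t * y - q * x) else (2, t).

Definition lucas t q n := (lucas2 t q n).1.

Lemma lucas0 t q : lucas t q 0 = 2. Proof. by []. Qed.
Lemma lucas1 t q : lucas t q 1 = t. Proof. by []. Qed.
Lemma lucasS t q n : lucas t q n.+2 = t * lucas t q n.+1 - q * lucas t q n.
Proof. by rewrite /lucas /=; case: (lucas2 t q n) => x y. Qed.

Variable F : finFieldType.
Hypothesis oddF : odd #|F|.
Variables a b : F.
Hypothesis sqfree : forall x, (cubic a b).[x] = 0 -> 3%:R * x ^+ 2 + a != 0.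

(** As L(T) = 1 + c T + q T^2, Newton's identities reduce to the recurrence of [lucas]; the sign
    comes from the logarithmic derivative. *)
Lemma psum_lucas N n : (n < N)%N ->
  psum a b N n.+1 = - lucas (- \sum_(x : F) qchar (cubic a b).[x]) #|F|%:R n.+1.
Proof.
set c := \sum_x _; set q := #|F|%:R; elim/ltn_ind: n => -[|[|n]] IH nN.
- have := newton_lcoef oddF a b nN.
  by rewrite big_ord1 subnn lcoef0 lcoef1 -/c mulr1 mul1r lucas1 opprK => <-.
- have := newton_lcoef oddF a b nN; rewrite big_ord_recr big_ord1 /= subnn lcoef0 (lcoef2 oddF sqfree).
  rewrite (IH 0%N) // 1?ltnW // lucasS lucas1 lucas0 lcoef1 -/c -/q => h.
  rewrite mulr1 opprK in h; have -> : psum a b N 2 = 2 * q - c * c by rewrite h; ring.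
  ring.
have := newton_lcoef oddF a b nN; rewrite (lcoef_eq0 oddF) mulr0 !big_ord_recr /= big1; last first.
  move=> j _; have [k ->] : exists k, (n.+3 - j.+1 = k.+3)%N.
    by exists (n - j.+1)%N; have := ltn_ord j; lia.
  by rewrite (lcoef_eq0 oddF) mulr0.
have -> : (n.+3 - n.+1 = 2)%N by lia.
have -> : (n.+3 - n.+2 = 1)%N by lia.
rewrite subnn lcoef0 lcoef1 (lcoef2 oddF sqfree) -/c -/q.
rewrite (IH n.+1) // ?(IH n) // ?(ltn_trans _ nN) // add0r [lucas _ _ n.+3]lucasS => h.
have -> : psum a b N n.+3 = lucas (- c) q n.+1 * q + lucas (- c) q n.+2 * c.
  by apply/eqP; rewrite -subr_eq0; apply/eqP; rewrite [RHS]h; ring.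
ring.
Qed.

End PowerSums.

(** * Character sums over extension fields *)

Section OrderIter.

Variables (T : finType) (g : T -> T).
Hypothesis g_inj : injective g.

Lemma order_dvd_iter n x : iter n g x = x -> order g x %| n.
Proof.
have eo m : iter (m * order g x) g x = x.
  by elim: m => // m IH; rewrite mulSn iterD IH iter_order.
rewrite (divn_eq n (order g x)) addnC iterD eo => e.
have lt : n %% order g x < order g x by rewrite ltn_mod order_gt0.
by rewrite -(findex_iter lt) e findex0 add0n dvdn_mull.
Qed.

End OrderIter.

Section IrreducibleXn.

Local Open Scope ring_scope.
Variable F : finFieldType.

(** The class of X lies in the field F[X]/(v) with q^d elements, so it is fixed by the power
    q^(dm). *)
Lemma irreducible_dvd_genPoly d m (v : 'rV[F]_d) : irreducibleb (mpol v) ->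
  mpol v %| 'X^(#|F| ^ (d * m)) - 'X.
Proof.
move=> /irreducibleP vi; have mi : monic_irreducible_poly (mpol v).
  by split=> //; apply: monic_mpol.
have cL : #|{poly %/ mpol v with mi}| = (#|F| ^ d)%N by rewrite card_qfpoly size_mpol.
have powL k (x : {poly %/ mpol v with mi}) : x ^+ (#|F| ^ (d * k)) = x.
  elim: k => [|k IH]; first by rewrite muln0 expn0 expr1.
  by rewrite mulnS addnC expnD exprM IH -cL expf_card.
have : in_qpoly (mpol v) ('X^(#|F| ^ (d * m)) - 'X) = 0.
  rewrite rmorphB rmorphXn /=.
  have := powL m (in_qpoly (mpol v) 'X) => /= ->; exact: subrr.
move/(congr1 val) => /=; rewrite mk_monicE // -Pdiv.IdomainMonic.modpE ?monic_mpol //.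
by move/eqP; rewrite -/(_ %| _).
Qed.

End IrreducibleXn.

Section Extension.

Local Open Scope ring_scope.
Variables F K : finFieldType.
Hypothesis oddF : odd #|F|.
Variable iota : {rmorphism F -> K}.
Variable k : nat.
Hypothesis k_gt0 : (0 < k)%N.
Hypothesis cardK : #|K| = (#|F| ^ k)%N.
Local Notation q := #|F|.

Definition frob (x : K) : K := x ^+ q.

Lemma pnat_card : [pchar K].-nat q.
Proof.
have [p p_pr pF] := finPcharP F.
have pK : p \in [pchar K] by rewrite (fmorph_pchar iota).
rewrite (card_pprimeChar pF) (eq_pnat _ (pcharf_eq pK)) pnatX.
by rewrite pnat_id.
Qed.

Lemma frob_zmod_morphism : zmod_morphism frob.
Proof. by move=> x y; rewrite /frob exprDn_pchar ?pnat_card // exprNn_pchar ?pnat_card. Qed.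

Lemma frob_monoid_morphism : monoid_morphism frob.
Proof. by split=> [|x y]; rewrite /frob ?expr1n ?exprMn. Qed.

HB.instance Definition _ := GRing.isZmodMorphism.Build K K frob frob_zmod_morphism.
HB.instance Definition _ := GRing.isMonoidMorphism.Build K K frob frob_monoid_morphism.

Lemma iter_frob n x : iter n frob x = x ^+ (q ^ n).
Proof. by elim: n => [|n IH]; rewrite ?expr1 // iterS IH /frob -exprM expnSr. Qed.

Lemma frob_inj : injective frob.
Proof. exact: fmorph_inj. Qed.

Lemma frob_iota c : frob (iota c) = iota c.
Proof. by rewrite /frob -rmorphXn expf_card. Qed.

(** The image of [F] already supplies all q roots of X^q - X. *)
Lemma frob_fixed x : frob x = x -> exists c, x = iota c.
Proof.
move=> fx; have [c /eqP <-|no] := pickP (fun c => iota c == x); first by exists c.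
have rts : all (root ('X^q - 'X)) (x :: [seq iota c | c <- enum F]).
  rewrite /= rootE !hornerE -/(frob x) fx subrr eqxx /=.
  by apply/allP => _ /mapP [c _ ->]; rewrite rootE !hornerE -/(frob _) frob_iota subrr.
have un : uniq (x :: [seq iota c | c <- enum F]).
  rewrite /= map_inj_uniq ?enum_uniq ?andbT; last exact: fmorph_inj.
  by apply/negP => /mapP [c _ e]; have := no c; rewrite e eqxx.
have sz : size ('X^q - 'X : {poly K}) = q.+1.
  by rewrite size_polyDl size_polyXn // size_polyN size_polyX ltnS finNzRing_gt1.
have := max_poly_roots _ rts un; rewrite -size_poly_eq0 sz => /(_ isT).
by rewrite /= size_map -cardE ltnn.
Qed.

Lemma frob_horner (p : {poly F}) x :
  frob (map_poly iota p).[x] = (map_poly iota p).[frob x].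
Proof.
rewrite -horner_map -map_poly_comp; congr _.[_].
by apply: eq_map_poly => c /=; rewrite frob_iota.
Qed.

Lemma iter_frob_horner (p : {poly F}) n x :
  iter n frob (map_poly iota p).[x] = (map_poly iota p).[iter n frob x].
Proof. by elim: n => // n IH; rewrite !iterS IH frob_horner. Qed.

(** The minimal polynomial of [x] over [F], as the product over its Frobenius conjugates. *)
Definition orbpoly (x : K) : {poly K} := \prod_(y <- orbit frob x) ('X - y%:P).

Lemma map_orbpoly x : map_poly frob (orbpoly x) = orbpoly x.
Proof.
rewrite /orbpoly rmorph_prod /=; under eq_bigr do rewrite rmorphB /= map_polyX map_polyC /=.
rewrite -(big_map frob xpredT (fun y => 'X - y%:P)); apply: perm_big.
apply: uniq_perm; rewrite ?orbit_uniq ?map_inj_uniq ?orbit_uniq //; first exact: frob_inj.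
have inc : {subset map frob (orbit frob x) <= orbit frob x}.
  by move=> _ /mapP [y yx ->]; apply: mem_orbit.
apply: (uniq_min_size _ inc _).2; rewrite ?size_map //.
by rewrite map_inj_uniq ?orbit_uniq //; exact: frob_inj.
Qed.

Lemma orbpoly_descent x : exists v : 'rV[F]_(order frob x), map_poly iota (mpol v) = orbpoly x.
Proof.
have /fin_all_exists [c hc] (i : 'I_(size (orbpoly x))) : exists c, (orbpoly x)`_i = iota c.
  by apply: frob_fixed; rewrite -[LHS]coef_map map_orbpoly.
pose g : {poly F} := \poly_(i < size (orbpoly x)) (if insub i is Some j then c j else 0).
have gE : map_poly iota g = orbpoly x.
  apply/polyP => i; rewrite coef_map coef_poly; case: ltnP => [lt|ge] /=.
    by rewrite insubT /= -hc.
  by rewrite rmorph0 nth_default.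
exists (vpol _ g); rewrite vpolK // -?(size_map_poly iota) ?gE.
  by rewrite -(map_monic iota) gE monic_prod_XsubC.
by rewrite size_prod_XsubC size_orbit.
Qed.

Lemma root_orbpoly x y : root (orbpoly x) y = (y \in orbit frob x).
Proof. by rewrite /orbpoly root_prod_XsubC. Qed.

Lemma root_orbit_size (p : {poly F}) x : p != 0 -> root (map_poly iota p) x ->
  (order frob x < size p)%N.
Proof.
move=> p0 px; have := @max_poly_roots _ (map_poly iota p) (orbit frob x).
rewrite map_poly_eq0 p0 orbit_uniq size_orbit size_map_poly => -> //.
apply/allP => y; rewrite -fconnect_orbit => /iter_findex <-.
rewrite rootE -iter_frob_horner (eqP px); apply/eqP.
by elim: findex => //= n ->; apply: rmorph0.
Qed.

(** A factor vanishing at [x] vanishes on the whole orbit, so it already has full degree. *)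
Lemma orbpoly_irreducible x (v : 'rV[F]_(order frob x)) :
  map_poly iota (mpol v) = orbpoly x -> irreducibleb (mpol v).
Proof.
move=> hv; apply/irreducibleP; split; first by rewrite size_mpol ltnS order_gt0.
move=> g sg /dvdpP [h' hg']; pose h : {poly F} := h'; have hg : mpol v = h * g := hg'.
have [h0 g0] : h != 0 /\ g != 0 by apply/andP; rewrite -negb_or -mulf_eq0 -hg mpol_neq0.
have : root (map_poly iota (mpol v)) x by rewrite hv root_orbpoly in_orbit.
have ss : ((size h + size g).-1 = (order frob x).+1)%N by rewrite -size_mul // -hg size_mpol.
have [sh0 sg0] : (0 < size h)%N /\ (0 < size g)%N by rewrite !size_poly_gt0.
rewrite hg rmorphM rootM => /orP [] /root_orbit_size => [/(_ h0) hx|/(_ g0) gx].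
  by case/eqP: sg; lia.
have arith (i j o : nat) : (0 < i -> (i + j).-1 = o.+1 -> o < j -> j = (i + j).-1)%N by lia.
by rewrite -dvdp_size_eqp ?dvdp_mull // size_mul //; apply/eqP; apply: arith sh0 ss gx.
Qed.

Lemma irreducible_root_orbpoly d (v : 'rV[F]_d) x : irreducibleb (mpol v) ->
  root (map_poly iota (mpol v)) x ->
  d = order frob x /\ map_poly iota (mpol v) = orbpoly x.
Proof.
move=> vi vx; have [w hw] := orbpoly_descent x; have wi := orbpoly_irreducible hw.
have [e|ne] := eqVneq (mpol v) (mpol w).
  by split; [have := size_mpol v; rewrite e size_mpol => -[] | rewrite e].
have /irreducibleP vi' := vi; have /irreducibleP wi' := wi.
have := irreducible_monic_coprime (monic_mpol v) (monic_mpol w) vi' wi' ne.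
rewrite -(coprimep_map iota) hw => /coprimep_root /(_ vx).
by rewrite -/(root _ x) root_orbpoly in_orbit.
Qed.

Lemma order_frob_dvd x : (order frob x %| k)%N.
Proof. by apply: (order_dvd_iter frob_inj); rewrite iter_frob -cardK expf_card. Qed.

(** When d divides k, [mpol v] divides X^(q^k) - X, which splits over [K]. *)
Lemma irreducible_has_root d (v : 'rV[F]_d) : irreducibleb (mpol v) -> (d %| k)%N ->
  exists x, root (map_poly iota (mpol v)) x.
Proof.
move=> vi /dvdnP [m km].
have : map_poly iota (mpol v) %| \prod_(x : K) ('X - x%:P).
  rewrite -finField_genPoly cardK km mulnC.
  by rewrite -(map_polyXn iota) -(map_polyX iota) -rmorphB /= dvdp_map irreducible_dvd_genPoly.
case/dvdp_prod_XsubC => [s hs].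
case E : (mask s (index_enum K)) hs => [|x t] hs.
  move: (eqp_size hs); rewrite big_nil size_poly1 size_map_poly size_mpol => -[d0].
  by have := irreducibleb_gt0 vi; rewrite {1}d0.
exists x; rewrite (eqp_root hs) big_cons rootM; apply/orP; left.
by rewrite root_XsubC.
Qed.

Variables a b : F.
Local Notation fK := (cubic (iota a) (iota b)).

Lemma frob_cubic n x : (fK.[x]) ^+ (q ^ n) = fK.[iter n frob x].
Proof. by rewrite -map_cubic -iter_frob_horner iter_frob. Qed.

Lemma oddK : odd #|K|.
Proof. by rewrite cardK oddX oddF orbT. Qed.

(** The argument of the character in [lchar] is the product of f(x)^(q^i) for i < d, as the two
    signs (-1)^d cancel. Its power [m.+1] is the norm of f(x) from [K] to [F]. *)
Lemma qchar_cubic_orbit d (v : 'rV[F]_d) m x : irreducibleb (mpol v) ->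
  root (map_poly iota (mpol v)) x -> (d * m.+1 = k)%N ->
  qchar fK.[x] = lchar a b (mpol v) ^+ m.+1.
Proof.
move=> vi vx dk; have [de hv] := irreducible_root_orbpoly vi vx.
set c := (-1) ^+ (size (mpol v)).-1 * cnorm a b (mpol v).
have cE : iota c = \prod_(i < d) fK.[x] ^+ (q ^ i).
  rewrite rmorphM rmorphXn rmorphN1 /= map_cnorm hv /orbpoly cnorm_prod.
  under eq_bigr do rewrite cnormXsubC -mulN1r; rewrite big_split /=.
  rewrite big_const_seq count_predT iter_mulr_1 size_mpol /= size_orbit -de mulrA -exprMn mulrNN mul1r expr1n mul1r.
  rewrite /orbit -de (big_nth x) size_traject big_mkord; apply: eq_bigr => i _.
  by rewrite nth_traject // frob_cubic.
pose z := fK.[x]; have zd : z ^+ (q ^ d) = z by rewrite frob_cubic de iter_order //; exact: frob_inj.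
have nm j : \prod_(i < d * j) z ^+ (q ^ i) = (\prod_(i < d) z ^+ (q ^ i)) ^+ j.
  elim: j => [|j IH]; first by rewrite muln0 big_ord0.
  rewrite mulnS big_split_ord /= exprS; congr (_ * _); rewrite -IH.
  by apply: eq_bigr => i _; rewrite expnD exprM zd.
(* Euler's exponent over [K] is the norm exponent times Euler's exponent over [F]. *)
have hE : ((#|K|.-1)./2 = (\sum_(i < k) q ^ i) * (q.-1)./2)%N.
  apply: double_inj; rewrite -[RHS]muln2 -mulnA muln2.
  have -> : ((q.-1)./2.*2 = q.-1)%N by have := card_half oddF; lia.
  by rewrite mulnC -predn_exp -cardK; have := card_half oddK; lia.
apply: (qcharP oddK).
  by rewrite -qcharX //; exact: qchar_cases.
rewrite -(qcharX oddF) -/c -(rmorph_int iota) (qcharE oddF) -exprM mulnC exprM rmorphXn rmorphXn /= cE.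
by rewrite exprAC -nm dk -expr_sum -exprM -/z hE.
Qed.

(** Each [x] is a root of exactly one irreducible monic polynomial; its degree d divides k and its d
    roots contribute equally. *)
Lemma sum_qchar_extension : \sum_(x : K) qchar fK.[x] = psum a b k k.
Proof.
have un (x : K) : \sum_(d < k.+1) \sum_(v : 'rV[F]_d | irreducibleb (mpol v))
    (root (map_poly iota (mpol v)) x)%:R = 1 :> int.
  have [w hw] := orbpoly_descent x; have wi := orbpoly_irreducible hw.
  have ok : (order frob x < k.+1)%N by rewrite ltnS dvdn_leq ?order_frob_dvd.
  rewrite (bigD1 (Ordinal ok)) //= [X in _ + X]big1 ?addr0; last first.
    move=> d de; rewrite big1 // => v vi; case: (boolP (root _ _)) => // vx.
    by have [e _] := irreducible_root_orbpoly vi vx; case/eqP: de; apply/val_inj.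
  rewrite (bigD1 w) //= hw root_orbpoly in_orbit big1 ?addr0 // => v /andP [vi vw].
  case: (boolP (root _ _)) => // vx; have [_ e] := irreducible_root_orbpoly vi vx.
  case/eqP: vw; apply: (@mpol_inj F); apply: (map_poly_inj iota); first by rewrite e hw.
under eq_bigr => x _ do rewrite -[qchar _]mul1r -[X in X * _](un x) big_distrl /=.
rewrite exchange_big; apply: eq_bigr => d _ /=.
under eq_bigr do rewrite big_distrl /=.
rewrite exchange_big; apply: eq_bigr => v vi /=.
have d_gt0 := irreducibleb_gt0 vi.
have [dvd_k|ndk] := boolP (d %| k)%N; last first.
  rewrite big1 => [|x _]; last first.
    case: (boolP (root _ _)) => [vx|]; last by rewrite mul0r.
    have [e _] := irreducible_root_orbpoly vi vx.
    by case/negP: ndk; rewrite e order_frob_dvd.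
  rewrite big1 // => m _; case: eqP => [e|]; rewrite ?mul0r //.
  by case/negP: ndk; apply/dvdnP; exists m.+1; rewrite mulnC e.
have [m km] := dvdnP dvd_k; case: m km => [km|m km]; first by move: k_gt0; rewrite [X in (_ < X)%N]km.
have dk : (d * m.+1 = k)%N by rewrite mulnC.
have mk : (m < k)%N by rewrite -[X in (_ < X)%N]dk leq_pmull.
rewrite [RHS](bigD1 (Ordinal mk)) //= dk eqxx mul1r [X in _ = _ + X]big1 ?addr0; last first.
  move=> j jm; case: eqP => [e|]; rewrite ?mul0r //; case/eqP: jm; apply/val_inj => /=.
  by move/eqP: e; rewrite -[X in _ == X]dk eqn_pmul2l // => /eqP [].
have [x vx] := irreducible_has_root vi dvd_k; have [e hv] := irreducible_root_orbpoly vi vx.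
transitivity (\sum_(y : K) (y \in orbit frob x)%:R * lchar a b (mpol v) ^+ m.+1).
  apply: eq_bigr => y _; rewrite hv root_orbpoly.
  case: (boolP (y \in _)) => [yx|]; last by rewrite !mul0r.
  by rewrite (@qchar_cubic_orbit d v m) // hv root_orbpoly.
rewrite -big_distrl /= -card_sum_int; congr (_ * _).
by rewrite (card_uniqP (orbit_uniq _ _)) size_orbit -e natz.
Qed.

End Extension.

(** * A Stepanov-Bombieri bound *)

Section DistinctSizes.

Local Open Scope ring_scope.

(** A nonzero term of largest degree could not be cancelled by the others. *)
Lemma sum_distinct_size (R : nzRingType) (I : finType) (G : I -> {poly R}) :
  (forall i j, G i != 0 -> G j != 0 -> size (G i) = size (G j) -> i = j) ->
  \sum_i G i = 0 -> forall i, G i = 0.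
Proof.
move=> Ginj G0 i0; apply/eqP; case: (boolP (G i0 == 0)) => // Gi0.
case: (@arg_maxnP _ i0 (fun i => G i != 0) (fun i => size (G i)) Gi0) => i Gi imax.
have := congr1 (fun p : {poly R} => p`_(size (G i)).-1) G0; rewrite coef_sum coef0.
rewrite (bigD1 i) //= big1 => [|j ji].
  by rewrite addr0 -lead_coefE => /eqP; rewrite lead_coef_eq0 (negbTE Gi).
have [->|Gj] := eqVneq (G j) 0; first by rewrite coef0.
rewrite nth_default // -ltnS prednK ?size_poly_gt0 // ltn_neqAle (imax j Gj : (_ <= _)%N) andbT.
by apply: contraNneq ji => /(Ginj _ _ Gj Gi) ->.
Qed.

End DistinctSizes.

Lemma eq_modular_digit (s i j x y : nat) : i < s -> j < s -> i + s * x = j + s * y -> i = j.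
Proof.
move=> si sj /(congr1 (modn^~ s)).
by rewrite ![s * _]mulnC ![_ + _ * s]addnC !modnMDl !modn_small.
Qed.

Section StepanovBombieri.

Local Open Scope ring_scope.
Variable K : finFieldType.
Variable n : nat.
Local Notation s := (n.*2.+3)%N.
Hypothesis cardK : #|K| = (s ^ 2)%N.
Hypothesis s_pchar : [pchar K].-nat s.
Variables a b : K.
Local Notation f := (cubic a b).

(** The rows of [A] and [D] are coefficient vectors of the unknown polynomials in Stepanov's
    construction, to be chosen so that this combination vanishes. *)
Definition stepT (A : 'M[K]_(n.+2, n.+4)) (D : 'M[K]_(n, n.+2)) : {poly K} :=
  \sum_(i < n.+2) 'X^(i * s) * rVpoly (row i A)
  - f ^+ n.+2 * \sum_(j < n) 'X^(j * s) * rVpoly (row j D).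

Definition stepH (A : 'M[K]_(n.+2, n.+4)) (D : 'M[K]_(n, n.+2)) : {poly K} :=
  \sum_(i < n.+2) 'X^i * rVpoly (row i A) ^+ s
  + f ^+ n.+2 * \sum_(j < n) 'X^j * rVpoly (row j D) ^+ s.

Lemma size_cubicX m : size (f ^+ m) = (3 * m).+1.
Proof.
have := size_exp f m; rewrite size_cubic /= => <-.
by rewrite prednK // size_poly_gt0 expf_neq0 // monic_neq0 // monic_cubic.
Qed.

Lemma size_sum_leq (I : finType) (G : I -> {poly K}) m :
  (forall i, size (G i) <= m)%N -> (size (\sum_i G i)%R <= m)%N.
Proof.
by move=> h; apply: (leq_trans (size_sum _ _ _)); apply/bigmax_leqP => i _.
Qed.

Lemma size_XnM_leq m k (p : {poly K}) : (size p <= k -> size ('X^m * p)%R <= m + k)%N.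
Proof.
move=> pk; apply: (leq_trans (size_polyMleq _ _)).
by rewrite size_polyXn /= leq_add2l.
Qed.

Lemma size_stepT A D : (size (stepT A D) <= (n ^ 2).*2 + 6 * n + 7)%N.
Proof.
apply: (leq_trans (size_polyD _ _)); rewrite size_polyN geq_max; apply/andP; split.
  apply: size_sum_leq => i; apply: (leq_trans (size_XnM_leq _ (size_rVpoly _))).
  have := ltn_ord i; rewrite ltnS => h; have : (i * s <= n.+1 * s)%N by rewrite leq_mul2r h orbT.
  nia.
apply: (leq_trans (size_polyMleq _ _)); rewrite size_cubicX addSn /=.
have [n0|n0] := posnP n.
  rewrite big1 ?size_poly0; first by lia.
  by move=> i _; have := ltn_ord i; rewrite [X in (_ < X)%N]n0.
have : (size (\sum_(j < n) 'X^(j * s) * rVpoly (row j D))%R <= n.-1 * s + n.+2)%N.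
  apply: size_sum_leq => i; apply: (leq_trans (size_XnM_leq _ (size_rVpoly _))).
  rewrite leq_add2r leq_mul2r; apply/orP; right; have := ltn_ord i; lia.
have : (n.-1 * s + s = n * s)%N by rewrite addnC -mulSn prednK.
rewrite -mulnn; move: (n.-1 * s)%N (size _) => t z e zt.
have : (n * s = (n * n).*2 + 3 * n)%N by lia.
lia.
Qed.

(** There are 2n^2 + 8n + 8 unknowns against 2n^2 + 6n + 7 coefficients, so two pairs collide; their
    difference is in the kernel. *)
Lemma exists_stepT : exists A D, stepT A D = 0 /\ (A, D) != (0, 0).
Proof.
pose phi (p : 'M[K]_(n.+2, n.+4) * 'M[K]_(n, n.+2)) :
  'rV[K]_((n ^ 2).*2 + 6 * n + 7) := poly_rV (stepT p.1 p.2).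
have /injectivePn [p [p' pp' e]] : ~~ injectiveb phi.
  apply/negP => /injectiveP /leq_card; rewrite card_prod !card_mx mul1n -expnD.
  have c1 : (1 < #|K|)%N := finNzRing_gt1 K.
  rewrite leq_exp2l //; nia.
exists (p.1 - p'.1), (p.2 - p'.2); split; last first.
  apply: contraNneq pp' => -[] /eqP; rewrite subr_eq0 => /eqP e1 /eqP; rewrite subr_eq0 => /eqP e2.
  by case: p p' e1 e2 {e} => [? ?] [? ?] /= -> ->.
have e' : stepT p.1 p.2 = stepT p'.1 p'.2.
  by move/(congr1 rVpoly): e; rewrite !poly_rV_K ?size_stepT.
suff -> : stepT (p.1 - p'.1) (p.2 - p'.2) = stepT p.1 p.2 - stepT p'.1 p'.2 by rewrite e' subrr.
rewrite /stepT; under eq_bigr do rewrite linearB linearB mulrBr /=.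
rewrite sumrB; under [X in _ - _ * X]eq_bigr do rewrite linearB linearB mulrBr /=.
by rewrite sumrB mulrBr !opprD !opprK !addrA; congr (_ + _); rewrite addrAC.
Qed.

Lemma exp_s_sum (I : finType) (G : I -> K) : (\sum_i G i) ^+ s = \sum_i G i ^+ s.
Proof.
apply: (big_morph (fun x => x ^+ s)); last by rewrite expr0n.
by move=> x y; rewrite exprDn_pchar.
Qed.

Lemma exp_card_horner (p : {poly K}) x : p.[x] ^+ s ^+ s = p.[x].
Proof. by rewrite -exprM mulnn -cardK expf_card. Qed.

(** The s-th power of [stepH] at x equals [stepT] at x: it is additive, values are fixed by the
    power s^2, and f(x)^((n+2)s) = -f(x)^(n+2) because (n+2)s = (s^2-1)/2 + n+2. *)
Lemma stepH_root A D x : odd #|K| -> stepT A D = 0 -> qchar f.[x] = -1 ->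
  root (stepH A D) x.
Proof.
move=> oddK T0 fx; rewrite rootE; suff : (stepH A D).[x] ^+ s == 0 by rewrite expf_eq0.
have h := congr1 (fun p : {poly K} => p.[x]) T0.
rewrite /= /stepT hornerD hornerN hornerM horner_exp !horner_sum horner0 in h.
rewrite /stepH hornerD hornerM horner_exp !horner_sum exprDn_pchar // exprMn !exp_s_sum.
have fe : f.[x] ^+ n.+2 ^+ s = - f.[x] ^+ n.+2.
  have := qcharE oddK f.[x]; rewrite fx => e.
  have -> : f.[x] ^+ n.+2 ^+ s = f.[x] ^+ ((#|K|.-1)./2) * f.[x] ^+ n.+2.
    rewrite -exprD -exprM; congr (_ ^+ _).
    by have := card_half oddK; rewrite {1}cardK; nia.
  by rewrite -e rmorphN1 mulN1r.
apply/eqP; rewrite -[RHS]h fe mulNr; congr (_ - _ * _); apply: eq_bigr => i _;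
by rewrite hornerM hornerXn horner_exp exprMn exp_card_horner -exprM hornerM hornerXn.
Qed.

Lemma size_XnM_exp m (p : {poly K}) : p != 0 -> size ('X^m * p ^+ s) = (m + s * (size p).-1).+1.
Proof.
move=> p0; have ps : p ^+ s != 0 by apply: expf_neq0.
have Xm : 'X^m != 0 :> {poly K} by rewrite monic_neq0 ?monicXn.
rewrite size_mul // size_polyXn; have := size_exp p s.
by rewrite -size_poly_gt0 in ps; rewrite mulnC => <-; rewrite addSn /= -addnS prednK.
Qed.

(** The nonzero summands have pairwise distinct degrees, already modulo s, so they cannot cancel. *)
Lemma stepH_neq0 A D : (A, D) != (0, 0) -> stepH A D != 0.
Proof.
apply: contra => /eqP H0.
pose G (i : 'I_n.+2 + 'I_n) : {poly K} := match i with
  | inl i => 'X^i * rVpoly (row i A) ^+ s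
  | inr j => f ^+ n.+2 * ('X^j * rVpoly (row j D) ^+ s) end.
have f0 : f ^+ n.+2 != 0 by rewrite expf_neq0 // monic_neq0 // monic_cubic.
have : forall i, G i = 0.
  apply: sum_distinct_size; last first.
    by rewrite big_sumType /= -[RHS]H0 /stepH big_distrr.
  have nz m (p : {poly K}) : 'X^m * p ^+ s != 0 -> p != 0.
    by apply: contraNneq => ->; rewrite expr0n mulr0.
  have nzf j (p : {poly K}) : f ^+ n.+2 * ('X^j * p ^+ s) != 0 -> 'X^j * p ^+ s != 0.
    by apply: contraNneq => ->; rewrite mulr0.
  have szf j (p : {poly K}) : p != 0 ->
      size (f ^+ n.+2 * ('X^j * p ^+ s)) = (3 * n.+2 + j + s * (size p).-1).+1.
    move=> p0; have q0 : 'X^j * p ^+ s != 0.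
      by apply: mulf_neq0; [rewrite monic_neq0 ?monicXn | apply: expf_neq0].
    rewrite size_mul // size_cubicX size_XnM_exp //; lia.
  (* Doubling turns 3(n+2) into 3s + 3, so comparing residues modulo s gives 2i = 2j + 3, which
     parity forbids. *)
  have cross (i j x y : nat) : (i < n.+2 -> j < n -> i + s * x = 3 * n.+2 + j + s * y -> False)%N.
    move=> hi hj e; have : (i.*2 = j.*2 + 3)%N.
      by apply: (@eq_modular_digit s _ _ x.*2 (y.*2 + 3)%N); [lia | lia | nia].
    lia.
  case=> i [] j /=.
  - move=> /nz hi /nz hj; rewrite !size_XnM_exp // => -[/eq_modular_digit e].
    by congr inl; apply/val_inj; apply: e; have := ltn_ord i; have := ltn_ord j; lia.
  - move=> /nz hi /nzf/nz hj; rewrite szf // size_XnM_exp // => -[e].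
    by case: (cross _ _ _ _ (ltn_ord i) (ltn_ord j) e).
  - move=> /nzf/nz hi /nz hj; rewrite szf // size_XnM_exp // => -[/esym e].
    by case: (cross _ _ _ _ (ltn_ord j) (ltn_ord i) e).
  - move=> /nzf/nz hi /nzf/nz hj; rewrite !szf // -!addnA => -[/eqP].
    rewrite eqn_add2l => /eqP /eq_modular_digit e.
    by congr inr; apply/val_inj; apply: e; have := ltn_ord i; have := ltn_ord j; lia.
have Xn0 m : ('X^m == 0 :> {poly K}) = false by apply/negbTE; rewrite monic_neq0 ?monicXn.
move=> Gz; rewrite xpair_eqE; apply/andP; split; apply/eqP/row_matrixP => i; rewrite row0.
  have /eqP := Gz (inl i); rewrite /= mulf_eq0 Xn0 expf_eq0 /=.
  by move/eqP => e; rewrite -[LHS]rVpolyK e linear0.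
have /eqP := Gz (inr i); rewrite /= mulf_eq0 (negbTE f0) mulf_eq0 Xn0 expf_eq0 /=.
by move/eqP => e; rewrite -[LHS]rVpolyK e linear0.
Qed.

Lemma size_stepH A D : (size (stepH A D) <= (n ^ 2).*2 + 10 * n + 11)%N.
Proof.
have szp k m (v : 'rV[K]_k.+1) : (size ('X^m * rVpoly v ^+ s)%R <= m + (s * k).+1)%N.
  apply: size_XnM_leq; apply: (leq_trans (size_poly_exp_leq _ _)).
  rewrite ltnS mulnC leq_mul2l; apply/orP; right.
  by rewrite -subn1 leq_subLR size_rVpoly.
apply: (leq_trans (size_polyD _ _)); rewrite geq_max; apply/andP; split.
  apply: size_sum_leq => i; apply: (leq_trans (szp _ _ _)); have := ltn_ord i; nia.
apply: (leq_trans (size_polyMleq _ _)); rewrite size_cubicX addSn /=.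
have [n0|n0] := posnP n.
  rewrite big1 ?size_poly0; first by lia.
  by move=> i _; have := ltn_ord i; rewrite [X in (_ < X)%N]n0.
have : (size (\sum_(j < n) 'X^j * rVpoly (row j D) ^+ s)%R <= n.-1 + (s * n.+1).+1)%N.
  apply: size_sum_leq => i; apply: (leq_trans (szp _ _ _)).
  by rewrite leq_add2r; have := ltn_ord i; lia.
rewrite -mulnn; move: (size _) => z zt.
have : (s * n.+1 = (n * n).*2 + 5 * n + 3)%N by lia.
lia.
Qed.

(** Character -1 occurs only at roots of [stepH], at most 2n^2 + 10n + 10 times, and f has at most 3
    zeros; s^2 - 2(2n^2 + 10n + 10) - 3 = -4s - 2. *)
Lemma sum_qchar_cubic_ge : - 4%:R * s%:R - 2%:R <= \sum_(x : K) qchar f.[x].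
Proof.
have oddK : odd #|K| by rewrite cardK oddX /= odd_double.
have [A [D [T0 AD]]] := exists_stepT.
pose M := [set x : K | qchar f.[x] == -1]; pose Z := [set x : K | f.[x] == 0].
have Nm : (#|M| <= (n ^ 2).*2 + 10 * n + 10)%N.
  rewrite -ltnS -addnS; apply: leq_trans (size_stepH A D); rewrite cardE.
  apply: max_poly_roots; rewrite ?stepH_neq0 ?enum_uniq //.
  by apply/allP => x; rewrite mem_enum inE => /eqP; apply: stepH_root.
have N0 : (#|Z| <= 3)%N.
  rewrite cardE -ltnS; rewrite -[X in (_ < X)%N](size_cubic a b); apply: max_poly_roots; rewrite ?monic_neq0 ?monic_cubic ?enum_uniq //.
  by apply/allP => x; rewrite mem_enum inE.
have E : \sum_(x : K) qchar f.[x] = #|K|%:Z - 2%:R * #|M|%:Z - #|Z|%:Z.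
  rewrite !card_sum_int big_distrr /= -!sumrB; apply: eq_bigr => x _; rewrite !inE.
  by rewrite -(qchar_eq0 f.[x]); case/or3P: (qchar_cases f.[x]) => /eqP ->.
rewrite E cardK; nia.
Qed.

End StepanovBombieri.

(** * Point counts over the extensions of the prime field *)

Section Lucas.

Local Open Scope ring_scope.

(** The squares of the roots of X^2 - tX + q have sum t^2 - 2q and product q^2. *)
Lemma lucas_double (t q : int) n :
  lucas t q n.+2.*2 = (t ^+ 2 - 2 * q) * lucas t q n.+1.*2 - q ^+ 2 * lucas t q n.*2.
Proof. rewrite !doubleS !lucasS; ring. Qed.

(* If t^2 > 4q then the even terms exceed 2 q^j by a margin growing with j. *)
Lemma lucas_discriminant (t : int) (q : nat) : (1 < q)%N ->
  (forall j, (0 < j)%N -> lucas t q%:Z j.*2 <= 4 * q%:Z ^+ j + 2) -> t ^+ 2 <= 4 * q%:Z.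
Proof.
move=> q1 H; have [//|gt] := leP; exfalso.
pose V j := lucas t q%:Z j.*2.
have qj j : 0 < q%:Z ^+ j by rewrite exprn_gt0 //; lia.
have V1 : V 1%N = t ^+ 2 - 2 * q%:Z.
  by rewrite /V (_ : 1.*2 = 2)%N // lucasS lucas1 lucas0; ring.
have step j : q%:Z * V j + q%:Z ^+ j <= V j.+1 /\ 2 * q%:Z ^+ j <= V j.
  elim: j => [|j [IH1 IH2]].
    by rewrite V1 /V lucas0 !expr0; lia.
  have h2 : 2 * q%:Z ^+ j.+1 <= V j.+1 by rewrite exprS; have := qj j; nia.
  split=> //; have -> : V j.+2 = (t ^+ 2 - 2 * q%:Z) * V j.+1 - q%:Z ^+ 2 * V j.
    exact: lucas_double.
  have := qj j.+1; move: IH1 h2; move: (V j.+1) (V j) (q%:Z ^+ j.+1) => x y z.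
  rewrite exprS; nia.
have lin j : (2 * q%:Z + j%:Z) * q%:Z ^+ j <= q%:Z * V j.
  elim: j => [|j IH]; first by rewrite /V lucas0 expr0; lia.
  have [h _] := step j.
  have -> : (2 * q%:Z + j.+1%:Z) * q%:Z ^+ j.+1 =
     q%:Z * ((2 * q%:Z + j%:Z) * q%:Z ^+ j + q%:Z ^+ j) by rewrite exprS intS; ring.
  rewrite ler_wpM2l //; apply: le_trans h; rewrite lerD2r //.
(* At j = 4q the lower bound 6 q^(j+1) for q V(j) exceeds the assumed upper bound 4 q^(j+1) + 2q. *)
have := lin (4 * q)%N; have := H (4 * q)%N; rewrite muln_gt0 (ltnW q1) => /(_ isT).
have : q%:Z <= q%:Z ^+ (4 * q).
  by rewrite -{1}[q%:Z]expr1 ler_eXn2l // ?ltr1n // muln_gt0 /= (ltnW q1).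
rewrite -/(V _); move: (V _) (_ ^+ _) => x y; nia.
Qed.

End Lucas.

Section PrimeField.

Local Open Scope ring_scope.
Variable p : nat.
Hypothesis p_pr : prime p.
Hypothesis p_gt2 : (2 < p)%N.

Lemma odd_card_Fp : odd #|'F_p|.
Proof. by rewrite card_Fp //; case: (even_prime p_pr) p_gt2 => [->|]. Qed.

Lemma Fp_rmorphism (K : finFieldType) k : #|K| = (p ^ k)%N ->
  exists iota : {rmorphism 'F_p -> K}, True.
Proof.
move=> cK; have pK := card_finPcharP cK p_pr.
by exists (in_alg (pPrimeCharType pK) : {rmorphism 'F_p -> pPrimeCharType pK}).
Qed.

Variables a b : 'F_p.
Local Notation f := (cubic a b).
Hypothesis sqfree : forall x, f.[x] = 0 -> 3%:R * x ^+ 2 + a != 0.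

(** This is the trace of Frobenius p - N_1, since N_1 is p plus the character sum. *)
Definition trace : int := - \sum_(x : 'F_p) qchar f.[x].

Lemma sum_qchar_lucas (K : finFieldType) (iota : {rmorphism 'F_p -> K}) k :
  (0 < k)%N -> #|K| = (p ^ k)%N ->
  \sum_(x : K) qchar (cubic (iota a) (iota b)).[x] = - lucas trace p%:Z k.
Proof.
move=> k_gt0 cK; have odF := odd_card_Fp.
have cK' : #|K| = (#|'F_p| ^ k)%N by rewrite card_Fp.
rewrite (sum_qchar_extension odF iota k_gt0 cK'); case: k k_gt0 cK cK' => // k _ _ _.
by rewrite (psum_lucas odF sqfree) // card_Fp // natz.
Qed.

Lemma hasse_bound : trace ^+ 2 <= 4 * p%:Z.
Proof.
apply: lucas_discriminant; first exact: prime_gt1.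
move=> j j_gt0; have j2_gt0 : (0 < j.*2)%N by rewrite double_gt0.
have [K pK cK] := pPrimePowerField p_pr j2_gt0; have [iota _] := Fp_rmorphism cK.
have := sum_qchar_lucas iota; move=> /(_ _ j2_gt0 cK).
have pj_odd : odd (p ^ j) by rewrite oddX -[p](card_Fp p_pr) odd_card_Fp orbT.
have pj3 : (2 < p ^ j)%N.
  by apply: (leq_trans p_gt2); rewrite -{1}[p]expn1 leq_exp2l // prime_gt1.
(* The Stepanov bound is stated for s = 2n + 3; here s = p^j, odd and at least 3. *)
pose n := ((p ^ j).-1./2).-1.
have nE : (p ^ j = n.*2.+3)%N by have := odd_double_half (p ^ j); rewrite pj_odd /n; lia.
have cK2 : #|K| = (n.*2.+3 ^ 2)%N by rewrite -nE cK -muln2 expnM.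
have pn : [pchar K].-nat n.*2.+3.
  by rewrite -nE pnatX (eq_pnat _ (pcharf_eq pK)) pnat_id.
have := sum_qchar_cubic_ge cK2 pn (iota a) (iota b); rewrite -nE => h1 h2.
have e : p%:Z ^+ j = (p ^ j)%N%:R by rewrite natrX natz.
move: h1; rewrite h2 e; move: ((p ^ j)%N%:R) => x; lia.
Qed.

End PrimeField.

(** * The trace modulo the characteristic *)

Section PowerSumsField.

Local Open Scope ring_scope.
Variable F : finFieldType.
Local Notation q := #|F|.

Lemma exists_expr_neq1 i : (0 < i < q.-1)%N -> exists g : F, g != 0 /\ g ^+ i != 1.
Proof.
move=> /andP [i0 iq]; have [g /andP [g0 gi]|no] := pickP (fun g : F => (g != 0) && (g ^+ i != 1)).
  by exists g.
have rts : all (root ('X^i - 1%:P)) (enum [set~ (0 : F)]).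
  apply/allP => x; rewrite mem_enum !inE => x0; have := no x; rewrite x0 /= => /negbFE/eqP xi.
  by rewrite rootE !hornerE xi subrr.
have := max_poly_roots _ rts (enum_uniq _); rewrite -cardE cardsC1 size_XnsubC //.
rewrite monic_neq0 ?monicXnsubC // => /(_ isT); rewrite ltnS leqNgt.
by rewrite iq.
Qed.

(** Substituting g x for x multiplies the sum by g^i, which differs from 1 for a suitable g; for i =
    0 the sum is q = 0. *)
Lemma sum_expr_eq0 i : (i < 2 * q.-1)%N -> i != q.-1 -> \sum_(x : F) x ^+ i = 0.
Proof.
move=> iq inq; have q1 := finNzRing_gt1 F.
have q0 : (q%:R : F) = 0.
  have [p p_pr pF] := finPcharP F; have cF := card_pprimeChar pF.
  have n0 : (0 < logn p q)%N by case: (logn p q) cF q1 => // ->.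
  apply/eqP; rewrite -(dvdn_pcharf pF) cF.
  exact: dvdn_exp.
have [->|i0] := posnP i; first by under eq_bigr do rewrite expr0; rewrite sumr_const q0.
have [g [g0 gi]] : exists g : F, g != 0 /\ g ^+ i != 1.
  have [lt|ge] := ltnP i q.-1; first by apply: exists_expr_neq1; rewrite i0.
  (* Since g^(q-1) = 1, the exponent may be lowered by q - 1. *)
  have [|g [g0 gi]] := @exists_expr_neq1 (i - q.-1)%N; first by lia.
  exists g; split=> //; apply: contraNneq gi => gi.
  have gq : g ^+ q.-1 = 1.
    by apply: (mulfI g0); rewrite -exprS prednK ?expf_card ?mulr1 // ltnW.
  by apply/eqP; rewrite -[LHS]mulr1 -[X in _ * X]gq -exprD subnK ?gi.
set S := LHS; have : g ^+ i * S = S.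
  rewrite /S big_distrr /= [RHS](reindex_inj (mulfI g0)) /=.
  by apply: eq_bigr => x _; rewrite exprMn.
by move/eqP; rewrite -subr_eq0 -{2}[S]mul1r -mulrBl mulf_eq0 subr_eq0 (negbTE gi) => /eqP.
Qed.

Lemma sum_expr_pred : \sum_(x : F) x ^+ q.-1 = -1.
Proof.
have q1 := finNzRing_gt1 F.
have E (x : F) : x ^+ q.-1 = 1 - (x == 0)%:R.
  have [->|x0] := eqVneq; first by rewrite subrr expr0n; case: #|F| q1 => [|[]].
  by apply: (mulfI x0); rewrite -exprS prednK ?expf_card ?subr0 ?mulr1 // ltnW.
have Z : \sum_(x : F) x ^+ 0 = 0 by apply: sum_expr_eq0; case: #|F| q1 => [|[|]].
under eq_bigr do rewrite E; rewrite sumrB.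
rewrite [X in X - _](_ : _ = 0) ?sub0r; last by rewrite -[RHS]Z.
by congr (- _); rewrite (bigD1 0) //= eqxx big1 ?addr0 // => x /negbTE ->.
Qed.

Lemma sum_horner (g : {poly F}) : (size g <= 2 * q.-1)%N ->
  \sum_(x : F) g.[x] = - g`_q.-1.
Proof.
move=> sg; under eq_bigr do rewrite (horner_coef_wide _ sg).
rewrite exchange_big /=; have q1 := finNzRing_gt1 F.
have lt : (q.-1 < 2 * q.-1)%N by rewrite ltn_Pmull // -ltnS prednK // ltnW.
rewrite (bigD1 (Ordinal lt)) //= -big_distrr /= sum_expr_pred mulrN1 big1 ?addr0 // => i iq.
rewrite -big_distrr /= sum_expr_eq0 ?mulr0 //.
Qed.

Lemma sum_qchar_coef (a b : F) : odd q ->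
  (\sum_(x : F) qchar (cubic a b).[x])%:~R = - (cubic a b ^+ (q.-1)./2)`_q.-1 :> F.
Proof.
move=> oddF; rewrite -sum_horner.
  rewrite rmorph_sum; apply: eq_bigr => x _.
  by rewrite horner_exp; exact: (qcharE oddF).
apply: (leq_trans (leqSpred _)); rewrite size_exp size_cubic.
have := card_half_gt0 oddF; have := card_half oddF; move: #|F| => n; lia.
Qed.

End PowerSumsField.

Section Digits.

Lemma digit_sum X n (c : nat -> nat) m : (forall i, c i < X) -> m < n ->
  (\sum_(i < n) c i * X ^ i) %/ X ^ m %% X = c m.
Proof.
move=> cX; have X0 : 0 < X := leq_ltn_trans (leq0n _) (cX 0).
elim: m n c cX => [|m IH] [|n] c cX // mn; rewrite big_ord_recl expn0 muln1.
  rewrite divn1; under eq_bigr do rewrite expnSr mulnA; rewrite -big_distrl /=.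
  by rewrite addnC modnMDl modn_small.
under eq_bigr do rewrite expnSr mulnA; rewrite -big_distrl /=.
by rewrite expnS divnMA addnC divnMDl // (divn_small (cX 0)) addn0 (IH n (fun i => c i.+1)).
Qed.

End Digits.

Section NatCubic.

Local Open Scope ring_scope.
Variables A B : nat.

(** Over the naturals the coefficients of its powers can be read as digits. *)
Definition ncubic : {poly nat} := 'X^3 + A%:P * 'X + B%:P.

Lemma map_ncubic (R : fieldType) : map_poly (GRing.natmul (1 : R)) ncubic = cubic A%:R B%:R.
Proof.
by rewrite /ncubic /cubic !rmorphD rmorphM /= map_polyXn map_polyX !map_polyC /= mul_polyC.
Qed.

Lemma horner_ncubic X : ncubic.[X] = (X ^ 3 + A * X + B)%N.
Proof. by rewrite /ncubic !hornerE. Qed.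

(** The value at 1 is the sum of the nonnegative coefficients. *)
Lemma coef_ncubicX_leq h i : (((ncubic ^+ h)`_i)%R <= (1 + A + B) ^ h)%N.
Proof.
have -> : ((1 + A + B) ^ h)%N = (ncubic ^+ h).[1%N].
  rewrite horner_exp horner_ncubic muln1 exp1n.
  by elim: h => // h IH; rewrite expnS exprS IH.
rewrite horner_coef; have [lt|ge] := ltnP i (size (ncubic ^+ h)%R); last by rewrite nth_default.
rewrite (bigD1 (Ordinal lt)) //= expr1n mulr1; exact: leq_addr.
Qed.

End NatCubic.

(** * The arithmetic of the formula *)

Section TraceResidue.

Local Open Scope ring_scope.

Definition residue (A B p : nat) : nat :=
  ((((2 ^ (3 * p ^ 2) + A * 2 ^ (p ^ 2) + B) ^ (p %/ 2)
               %/ 2 ^ (p ^ 2 * (p - 1))) %% 2 ^ (p ^ 2)) %% p)%N.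

(** Kronecker substitution: all coefficients are below X = 2^(p^2), so the value at X lists them as
    base-X digits, and digit p - 1 is extracted. *)
Lemma residueE A B p : (1 < p)%N -> (A < p)%N -> (B < p)%N ->
  residue A B p = (((ncubic A B ^+ (p %/ 2)%N)`_p.-1)%R %% p)%N.
Proof.
move=> p1 Ap Bp; rewrite /residue; set X := (2 ^ (p ^ 2))%N.
have -> : (2 ^ (3 * p ^ 2) = X ^ 3)%N by rewrite mulnC expnM.
have -> : (2 ^ (p ^ 2 * (p - 1)) = X ^ p.-1)%N by rewrite expnM subn1.
set G := ncubic A B ^+ _.
have -> : ((X ^ 3 + A * X + B) ^ (p %/ 2))%N = G.[X].
  by rewrite /G horner_exp horner_ncubic; elim: (p %/ 2)%N => // h IH; rewrite expnS exprS IH.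
(* Padding the expansion to length at least p puts the index p - 1 in range. *)
have wide : (size G <= maxn (size G) p)%N by rewrite leq_maxl.
rewrite (horner_coef_wide _ wide).
rewrite (@digit_sum X _ (fun i => G`_i)) // => [i|]; last first.
  by rewrite leq_max orbC prednK ?leqnn // ltnW.
apply: (leq_ltn_trans (coef_ncubicX_leq _ _ _ _)).
(* The coefficients are at most (1 + A + B)^h <= (2p)^h <= 2^(ph) < 2^(p^2) with h = p/2 rounded
   down. *)
have p2 : (p <= 2 ^ p.-1)%N by rewrite -{1}(prednK (ltnW p1)) ltn_expl.
have pp : (2 * p <= 2 ^ p)%N by rewrite -{2}(prednK (ltnW p1)) expnS leq_mul2l p2.
apply: (@leq_ltn_trans ((2 ^ p) ^ (p %/ 2))); first by rewrite leq_exp2r ?divn_gt0 //; lia.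
rewrite -expnM ltn_exp2l // -mulnn ltn_mul2l ltn_Pdiv ?(ltnW p1) //.
Qed.

Lemma trace_residue (A B p : nat) : prime p -> (2 < p)%N -> (A < p)%N -> (B < p)%N ->
  (p%:Z %| trace (A%:R : 'F_p) B%:R - (residue A B p)%:Z)%Z.
Proof.
move=> p_pr p_gt2 Ap Bp; have pF := pchar_Fp p_pr.
rewrite (dvdz_pcharf pF) rmorphB /= subr_eq0 residueE ?prime_gt1 //.
have oddF := odd_card_Fp p_pr p_gt2.
rewrite /trace rmorphN /= (sum_qchar_coef _ _ oddF) opprK card_Fp //.
rewrite -pmulrn Fp_nat_mod // -map_ncubic -rmorphXn coef_map /=.
have -> : (p %/ 2 = p.-1./2)%N by have := odd_double_half p; rewrite -[in odd p](card_Fp p_pr) oddF; lia.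
by [].
Qed.

End TraceResidue.

(** * The truncated generating series and its remainder *)

Section Quotient.

Local Open Scope ring_scope.

(** With U the companion Lucas sequence, V^2 = 4q^n + (t^2 - 4q) U^2. The induction carries the
    doubled half-step formulas for U and V. *)
Lemma lucas_sqr (t q : int) n : t ^+ 2 <= 4 * q -> lucas t q n ^+ 2 <= 4 * q ^+ n.
Proof.
move=> tq.
suff [U [U' [_ [_ e]]]] : exists U U', 2 * U' = t * U + lucas t q n /\
    2 * lucas t q n.+1 = t * lucas t q n + (t ^+ 2 - 4 * q) * U /\
    lucas t q n ^+ 2 = 4 * q ^+ n + (t ^+ 2 - 4 * q) * U ^+ 2.
  rewrite e; have : 0 <= (4 * q - t ^+ 2) * U ^+ 2 by rewrite mulr_ge0 ?sqr_ge0 // subr_ge0.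
  move: (q ^+ n) => z; nia.
elim: n => [|n [U [U' [h1 [h2 h3]]]]].
  by exists 0, 1; rewrite lucas0 lucas1 expr0; split; [|split]; ring.
exists U', (t * U' - q * U); rewrite lucasS.
have h4 : t * U' - 2 * q * U = lucas t q n.+1.
  apply: (@mulfI _ 2) => //; rewrite h2.
  have -> : 2 * (t * U' - 2 * q * U) = t * (2 * U') - 4 * q * U by ring.
  rewrite h1; ring.
split; first by rewrite -h4; ring.
split.
  have -> : 2 * (t * lucas t q n.+1 - q * lucas t q n) =
    t * lucas t q n.+1 + (t * lucas t q n.+1 - 2 * q * lucas t q n) by ring.
  congr (_ + _); apply: (@mulfI _ 2) => //.
  have -> : 2 * (t * lucas t q n.+1 - 2 * q * lucas t q n) =
    t * (2 * lucas t q n.+1) - 4 * q * lucas t q n by ring.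
  have -> : 2 * ((t ^+ 2 - 4 * q) * U') = (t ^+ 2 - 4 * q) * (2 * U') by ring.
  rewrite h2 h1; ring.
apply: (@mulfI _ 4) => //.
have -> : 4 * lucas t q n.+1 ^+ 2 = (2 * lucas t q n.+1) ^+ 2 by ring.
have -> : 4 * (4 * q ^+ n.+1 + (t ^+ 2 - 4 * q) * U' ^+ 2) =
  16 * q ^+ n.+1 + (t ^+ 2 - 4 * q) * (2 * U') ^+ 2 by ring.
rewrite h1 h2.
have -> : (t * lucas t q n + (t ^+ 2 - 4 * q) * U) ^+ 2 =
  4 * q * lucas t q n ^+ 2 + (t ^+ 2 - 4 * q) * lucas t q n ^+ 2
  + 2 * t * (t ^+ 2 - 4 * q) * U * lucas t q n + (t ^+ 2 - 4 * q) ^+ 2 * U ^+ 2 by ring.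
rewrite [in 4 * q * _]h3 (exprS q n); ring.
Qed.

(* sum_j (2 p^j + s_j) u^-j = u P(u) / Q(u) with s_j the power sums of the roots of
   X^2 - a X + p; the last summand is Q(u) times the tail of this series. *)
Lemma series_truncation (a p u : int) k : (forall j, 0 <= 2 * p ^+ j + lucas a p j) -> 0 <= u ->
  exists E : int, 0 <= E /\
   u ^+ k.+1 * (4 * u ^+ 2 - (3 * a + 2 * p) * u + p * (a + 2)) =
   (u ^+ 2 - a * u + p) * (u - p) * (E * u + (2 * p ^+ k + lucas a p k))
   + (2 * p ^+ k.+1 * (u ^+ 2 - a * u + p)
      + (lucas a p k.+1 * u - p * lucas a p k) * (u - p)).
Proof.
move=> c0 u0; elim: k => [|k [E [E0 IH]]].
  by exists 0; split=> //; rewrite lucas0 lucas1 !expr1 expr0; ring.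
exists (E * u + (2 * p ^+ k + lucas a p k)); split.
  by rewrite addr_ge0 ?mulr_ge0.
rewrite (exprS u) -mulrA IH lucasS !(exprS p); ring.
Qed.

(** Used with m = p^k, s = s_k and t = s_(k+1), where R is the last summand of [series_truncation].
    With M = pm and q2 the quadratic factor, the second summand is at most M u^2 <= 2 M q2 in size,
    so 0 <= R <= 4 M q2 < q2 (u - p). *)
Lemma remainder_bounds (a p u m s t : int) : 17 <= p -> a ^+ 2 <= 4 * p -> p <= m ->
  - m <= s <= m -> - (p * m) <= t <= p * m -> 100 * (p * m) <= u ->
  let R := 2 * (p * m) * (u ^+ 2 - a * u + p) + (t * u - p * s) * (u - p) in
  0 <= R /\ R < (u ^+ 2 - a * u + p) * (u - p).
Proof.
move=> p17 ap pm /andP [s1 s2] /andP [t1 t2] um R.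
have [a1 a2] : - p <= a /\ a <= p by split; nia.
have M0 : p * p <= p * m by nia.
set M := p * m in M0 t1 t2 um R *.
have u0 : 0 <= u by nia.
have D1 : - (M * (u + 1)) <= t * u - p * s by rewrite /M in t1 t2 *; nia.
have D2 : t * u - p * s <= M * (u + 1) by rewrite /M in t1 t2 *; nia.
have up : 0 <= u - p by nia.
set q2 := u ^+ 2 - a * u + p in R *.
have pM : p <= M by nia.
have q2u : u ^+ 2 <= 2 * q2.
  by have : 0 <= u * (u - 2 * a) by [apply: mulr_ge0; lia]; rewrite /q2 expr2; lia.
have uu : (u + 1) * (u - p) <= u ^+ 2.
  by have : 0 <= u * (p - 1) by [apply: mulr_ge0; lia]; rewrite expr2; lia.
have D3 : - (M * u ^+ 2) <= (t * u - p * s) * (u - p) <= M * u ^+ 2.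
  have M1 : 0 <= M by lia.
  have h := ler_wpM2l M1 uu.
  have h1 := ler_wpM2r up D1; have h2 := ler_wpM2r up D2.
  by apply/andP; split; [apply: le_trans h1 | apply: le_trans h2 _]; lia.
have D5 : M * u ^+ 2 <= M * (2 * q2) by apply: ler_wpM2l => //; lia.
move: D3 D5; rewrite /R; move: (_ * (u - p)) (M * u ^+ 2) => x y /andP [D3 D4] D5.
have q2_gt0 : 0 < q2 by have := sqr_ge0 u; nia.
split; first by nia.
have : 4 * M * q2 < q2 * (u - p) by rewrite mulrC ltr_pM2l //; lia.
lia.
Qed.

End Quotient.

(** The switch [i] is 1 exactly when r^2 > 4p. Hasse's bound then excludes a = r and leaves a = r -
    p. *)
Lemma signed_residue (a : int) (p r : nat) (i := 1 - ((4 * p + 1) - r ^ 2)) :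
  17 <= p -> r < p -> (a ^+ 2 <= 4 * p%:Z)%R -> (p%:Z %| (a - r%:Z)%R)%Z ->
  (a = (r * (1 - i))%:Z - (i * (p - r))%:Z)%R.
Proof.
move=> p17 rp ha /dvdzP [m hm].
have [le|gt] := leqP (r ^ 2) (4 * p).
  have -> : i = 0 by rewrite /i; lia.
  have le' : (r%:Z ^+ 2 <= 4 * p%:Z)%R by rewrite -mulnn in le; rewrite expr2; lia.
  (* (a - r)^2 <= 2a^2 + 2r^2 <= 16p < p^2; this is where p >= 17 enters. *)
  have m1 : ((m * p%:Z) ^+ 2 < p%:Z ^+ 2)%R.
    have := sqr_ge0 (a + r%:Z)%R; rewrite -hm.
    have -> : ((a - r%:Z) ^+ 2 = 2 * a ^+ 2 + 2 * r%:Z ^+ 2 - (a + r%:Z) ^+ 2)%R by ring.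
    have : (17 * p%:Z <= p%:Z ^+ 2)%R by rewrite expr2; nia.
    lia.
  have p2 : (0 < p%:Z ^+ 2)%R by rewrite expr2; nia.
  have m0 : m = 0%R.
    apply/eqP; case: (m =P 0%R) => // m0; move: m1; rewrite exprMn ltNge.
    have m2 : (1 <= m ^+ 2)%R by rewrite expr2; nia.
    by rewrite ler_peMl // ltW.
  rewrite m0 in hm; lia.
have -> : i = 1 by rewrite /i; lia.
have gt' : (4 * p%:Z < r%:Z ^+ 2)%R by rewrite -mulnn in gt; rewrite expr2; lia.
have [a1 a2] : (- p%:Z < a /\ a < p%:Z)%R by rewrite expr2 in ha; split; nia.
have m0 : m <> 0%R.
  move=> m0; rewrite m0 mul0r in hm; have e : a = Posz r by lia.
  by move: gt'; rewrite -e ltNge ha.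
have m1 : (m = -1)%R by nia.
by rewrite subnn muln0 mul1n m1 in hm *; lia.
Qed.

Lemma sqr_le_bounds (a p : int) : (17 <= p -> a ^+ 2 <= 4 * p -> - p <= a /\ a <= p)%R.
Proof. by rewrite expr2 => *; split; nia. Qed.

(** * Reading the point count off the integer quotient *)

Section Formula.

Definition final_count (p k ap am u : nat) : nat :=
  let Pp := 4 * u ^ 2 + 3 * am * u + p * (ap + 2) in
  let Pm := (3 * ap + 2 * p) * u + p * am in
  let P := Pp - Pm in
  let Q := ((u ^ 2 + am * u + p) - ap * u) * (u - p) in
  let F := (u ^ (k + 1) * P) %/ Q in
  3 * p ^ k - F %% u.

(** The truncated subtractions are exact, F = E u + c with c = 2p^k + s_k < u, and 3p^k - c = p^k -
    s_k. *)
Lemma final_countE (p k ap am u N : nat) (a : int) : 17 <= p -> 0 < k ->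
  (a = ap%:Z - am%:Z)%R -> (a ^+ 2 <= 4 * p%:Z)%R -> 100 * (p * p ^ k) <= u ->
  (N%:Z = p%:Z ^+ k - lucas a p%:Z k)%R -> final_count p k ap am u = N.
Proof.
move=> p17 k0 aE ha hu hN.
have powE j : (p%:Z ^+ j = (p ^ j)%:Z)%R by rewrite -[RHS]natz natrX natz.
have lb j : (lucas a p%:Z j ^+ 2 <= 4 * (p ^ j)%:Z)%R by rewrite -powE; apply: lucas_sqr.
have c0 j : (0 <= 2 * p%:Z ^+ j + lucas a p%:Z j)%R.
  rewrite powE; have := lb j; have : 0 < p ^ j by rewrite expn_gt0; lia.
  move: (lucas _ _ _) (p ^ j) => s z; nia.
(* s_j^2 <= 4 p^j <= p^(2j) for j >= 1; at j = 0 the bound fails, as s_0 = 2. *)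
have lk j : 0 < j -> (- (p ^ j)%:Z <= lucas a p%:Z j <= (p ^ j)%:Z)%R.
  move=> j0; have := lb j; have : p <= p ^ j by rewrite -{1}[p]expn1 leq_exp2l; lia.
  move: (lucas _ _ _) (p ^ j) => s z h1 h2; apply/andP; split; nia.
have pk : p <= p ^ k by rewrite -{1}[p]expn1 leq_exp2l; lia.
have u0 : (0 <= u%:Z)%R by [].
have [E [E0 eq]] := series_truncation k c0 u0.
have hl := lk k k0; have hl1 := lk k.+1 isT; rewrite expnS PoszM in hl1.
have hu' : (100 * (p%:Z * (p ^ k)%:Z) <= u%:Z)%R by lia.
have p17' : (17 <= p%:Z)%R by lia.
have pk' : (p%:Z <= (p ^ k)%:Z)%R by lia.
have [R0 R1] := remainder_bounds p17' ha pk' hl hl1 hu'.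
have [a1 a2] := sqr_le_bounds p17' ha.
have pu : (100 * p%:Z <= u%:Z)%R.
  suff : 100 * p <= u by lia.
  by apply: leq_trans hu; rewrite leq_mul2l leq_pmulr // expn_gt0; lia.
rewrite /final_count.
set P := (4 * u ^ 2 + 3 * am * u + p * (ap + 2) - ((3 * ap + 2 * p) * u + p * am)).
set Q := ((u ^ 2 + am * u + p) - ap * u) * (u - p).
have PE : (P%:Z = 4 * u%:Z ^+ 2 - (3 * a + 2 * p%:Z) * u%:Z + p%:Z * (a + 2))%R.
  rewrite /P -subzn; first by rewrite aE -mulnn; lia.
  suff : (0 <= 4 * u%:Z ^+ 2 - (3 * a + 2 * p%:Z) * u%:Z + p%:Z * (a + 2))%R by rewrite aE -mulnn; lia.
  have h1 : (p%:Z * p%:Z <= u%:Z * (4 * u%:Z - 3 * a - 2 * p%:Z))%R by apply: ler_pM; lia.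
  have h2 : (0 <= p%:Z * (p%:Z + a))%R by apply: mulr_ge0; lia.
  rewrite expr2; lia.
have QE : (Q%:Z = (u%:Z ^+ 2 - a * u%:Z + p%:Z) * (u%:Z - p%:Z))%R.
  rewrite /Q PoszM -[Posz (u - p)]subzn; last by lia.
  congr (_ * _)%R; rewrite -subzn; first by rewrite aE -mulnn; lia.
  suff : (0 <= u%:Z ^+ 2 - a * u%:Z + p%:Z)%R by rewrite aE -mulnn; lia.
  have h1 : (0 <= u%:Z * (u%:Z - a))%R by apply: mulr_ge0; lia.
  rewrite expr2; lia.
move: eq R0 R1; rewrite (exprS p%:Z) powE -QE -PE; set R := (X in (0 <= X)%R).
move=> eq R0 R1.
have c0k := c0 k; rewrite powE in c0k.
case: E E0 eq => // E _ eq; case RE : R R0 R1 => [R'|//] _ R1.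
have [c cE] : exists c : nat, (2 * (p ^ k)%:Z + lucas a p%:Z k = c%:Z)%R.
  by case: (2 * _ + _)%R c0k => // c _; exists c.
have cu : c < u.
  have : p ^ k <= p * p ^ k by apply: leq_pmull; lia.
  by case/andP: hl; lia.
have FE : u ^ (k + 1) * P = (E * u + c) * Q + R'.
  apply/eqP; rewrite -eqz_nat PoszD !PoszM addn1; apply/eqP.
  have -> : ((u ^ k.+1)%:Z = u%:Z ^+ k.+1)%R by rewrite -[LHS]natz natrX natz.
  rewrite eq cE -RE PoszD PoszM; congr (_ + _)%R; rewrite mulrC //.
have R1' : R' < Q by lia.
rewrite FE divnMDl; last by lia.
rewrite (divn_small R1') addn0.
rewrite modnMDl modn_small //.
rewrite powE in hN; lia.
Qed.

(** From 100p <= 2^p one gets u >= (100p)^(k+1), which explains the exponent (k+1)p. *)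
Lemma exp2_bound p k : 17 <= p -> 100 * (p * p ^ k) <= 2 ^ ((k + 1) * p).
Proof.
move=> p17; have h : 100 * p <= 2 ^ p.
  elim: p p17 => // p IH; rewrite leq_eqVlt => /orP [/eqP <- //|].
  rewrite ltnS => p17; have h := IH p17; rewrite expnS; lia.
rewrite addn1 -expnS [k.+1 * p]mulnC expnM.
apply: (@leq_trans ((100 * p) ^ k.+1)); last by rewrite leq_exp2r.
by rewrite expnMn leq_mul2r -{1}[100]expn1 leq_exp2l ?orbT.
Qed.

Lemma count_formulaE A B p k (r := residue (A %% p) (B %% p) p)
  (i := 1 - ((4 * p + 1) - r ^ 2)) :
  count_formula A B p k = final_count p k (r * (1 - i)) (i * (p - r)) (2 ^ ((k + 1) * p)).
Proof. by []. Qed.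

End Formula.

(** * The point count and the arithmetic term *)

Section PointCount.

Local Open Scope ring_scope.

Lemma card_affine_points (K : finFieldType) (a b : K) : odd #|K| ->
  #|affine_points a b|%:Z = #|K|%:Z + \sum_(x : K) qchar (cubic a b).[x].
Proof.
move=> oddK; rewrite card_sum_int; transitivity (\sum_x \sum_y ((x, y) \in affine_points a b)%:R : int).
  by rewrite pair_bigA; apply: eq_bigr => -[].
rewrite (eq_bigr (fun x => 1 + qchar (cubic a b).[x])) => [|x _].
  by rewrite big_split /= sumr_const natz.
by by rewrite -sum_eq_sqr // horner_cubic; apply: eq_bigr => y _; rewrite inE.
Qed.

(** A double root x forces A = -3x^2 and B = 2x^3, so the discriminant is -108x^6 + 108x^6 = 0. *)
Lemma discriminant_sqfree (A B p : nat) : prime p ->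
  (4 * A ^ 3 + 27 * B ^ 2 <> 0 %[mod p])%N ->
  forall x : 'F_p, (cubic A%:R B%:R).[x] = 0 -> 3%:R * x ^+ 2 + A%:R != 0.
Proof.
move=> p_pr disc x; rewrite horner_cubic => fx; apply/negP => /eqP dfx; apply: disc.
apply/eqP; rewrite mod0n -/(_ %| _)%N (dvdn_pcharf (pchar_Fp p_pr)).
rewrite natrD (natrM _ 4) (natrM _ 27) !natrX; apply/eqP.
have aE : A%:R = - (3%:R * x ^+ 2) :> 'F_p by apply/eqP; rewrite -addr_eq0 addrC dfx.
have bE : B%:R = 2%:R * x ^+ 3 :> 'F_p.
  have -> : B%:R = x ^+ 3 + A%:R * x + B%:R - x ^+ 3 - A%:R * x :> 'F_p by ring.
  by rewrite fx aE; ring.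
rewrite aE bE; ring.
Qed.

Lemma card_affine_points_formula (p k A B : nat) (K : finFieldType) :
  prime p -> (17 <= p)%N -> (1 <= k)%N ->
  (4 * (A %% p) ^ 3 + 27 * (B %% p) ^ 2 <> 0 %[mod p])%N -> #|K| = (p ^ k)%N ->
  #|@affine_points K (A %% p)%:R (B %% p)%:R| = count_formula A B p k.
Proof.
move=> p_pr p17 k1 disc cK; have p2 : (2 < p)%N by apply: leq_trans p17.
have sqf := discriminant_sqfree p_pr disc.
have Ap : (A %% p < p)%N by rewrite ltn_mod prime_gt0.
have Bp : (B %% p < p)%N by rewrite ltn_mod prime_gt0.
have [iota _] := Fp_rmorphism p_pr cK.
have oddK : odd #|K| by rewrite cK oddX -[p](card_Fp p_pr) odd_card_Fp // orbT.
have hasse := hasse_bound p_pr p2 sqf.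
have res := trace_residue p_pr p2 Ap Bp.
rewrite count_formulaE; apply/esym; apply: (final_countE _ _ _ hasse) => //.
- apply: (signed_residue _ _ hasse res) => //.
  by rewrite ltn_mod prime_gt0.
- exact: exp2_bound.
rewrite card_affine_points // -(rmorph_nat iota) -(rmorph_nat iota (B %% p)).
by rewrite (sum_qchar_lucas p_pr p2 sqf iota k1 cK) cK -[Posz (p ^ k)]natz natrX natz.
Qed.

End PointCount.

(** * The formula as an arithmetic term *)

Section ArithmeticTerm.

Variables (n : nat) (env : n.-tuple nat).
Implicit Types t : aterm n.

Definition AMod t1 t2 := ASub t1 (AMul t2 (ADiv t1 t2)).

Lemma aeval_add t1 t2 x y : aeval env t1 = Some x -> aeval env t2 = Some y ->
  aeval env (AAdd t1 t2) = Some (x + y).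
Proof. by move=> /= -> ->. Qed.

Lemma aeval_sub t1 t2 x y : aeval env t1 = Some x -> aeval env t2 = Some y ->
  aeval env (ASub t1 t2) = Some (x - y).
Proof. by move=> /= -> ->. Qed.

Lemma aeval_mul t1 t2 x y : aeval env t1 = Some x -> aeval env t2 = Some y ->
  aeval env (AMul t1 t2) = Some (x * y).
Proof. by move=> /= -> ->. Qed.

Lemma aeval_exp t1 t2 x y : aeval env t1 = Some x -> aeval env t2 = Some y ->
  aeval env (AExp t1 t2) = Some (x ^ y).
Proof. by move=> /= -> ->. Qed.

Lemma aeval_div t1 t2 x y : aeval env t1 = Some x -> aeval env t2 = Some y -> 0 < y ->
  aeval env (ADiv t1 t2) = Some (x %/ y).
Proof. by move=> /= -> -> ->. Qed.

Lemma aeval_mod t1 t2 x y : aeval env t1 = Some x -> aeval env t2 = Some y -> 0 < y ->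
  aeval env (AMod t1 t2) = Some (x %% y).
Proof.
move=> /= -> -> ->; congr Some.
by rewrite {1}(divn_eq x y) [y * _]mulnC addnC addnK.
Qed.

End ArithmeticTerm.

Definition count_term : aterm 4 :=
  let A := AVar (@Ordinal 4 0 isT) in
  let B := AVar (@Ordinal 4 1 isT) in
  let p := AVar (@Ordinal 4 2 isT) in
  let k := AVar (@Ordinal 4 3 isT) in
  let c m := AConst 4 m in
  let a := AMod A p in
  let b := AMod B p in
  let p2 := AExp p (c 2) in
  let X := AExp (c 2) p2 in
  let r := AMod (AMod
    (ADiv (AExp (AAdd (AAdd (AExp (c 2) (AMul (c 3) p2)) (AMul a X)) b) (ADiv p (c 2)))
          (AExp (c 2) (AMul p2 (ASub p (c 1))))) X) p in
  let i := ASub (c 1) (ASub (AAdd (AMul (c 4) p) (c 1)) (AExp r (c 2))) in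
  let ap := AMul r (ASub (c 1) i) in
  let am := AMul i (ASub p r) in
  let u := AExp (c 2) (AMul (AAdd k (c 1)) p) in
  let u2 := AExp u (c 2) in
  let Pp := AAdd (AAdd (AMul (c 4) u2) (AMul (AMul (c 3) am) u)) (AMul p (AAdd ap (c 2))) in
  let Pm := AAdd (AMul (AAdd (AMul (c 3) ap) (AMul (c 2) p)) u) (AMul p am) in
  let P := ASub Pp Pm in
  let Q := AMul (ASub (AAdd (AAdd u2 (AMul am u)) p) (AMul ap u)) (ASub u p) in
  let F := ADiv (AMul (AExp u (AAdd k (c 1))) P) Q in
  ASub (AMul (c 3) (AExp p k)) (AMod F u).

(** What needs proof is that denominators are positive; for [Q], a^+ <= p < u gives a^+ u < u^2. *)
Lemma aeval_count_term (A B p k : nat) : 0 < p ->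
  aeval [tuple A; B; p; k] count_term = Some (count_formula A B p k).
Proof.
move=> p0; rewrite /count_term /count_formula; set env := [tuple A; B; p; k].
have eA : aeval env (AVar (@Ordinal 4 0 isT)) = Some A by [].
have eB : aeval env (AVar (@Ordinal 4 1 isT)) = Some B by [].
have ep : aeval env (AVar (@Ordinal 4 2 isT)) = Some p by [].
have ek : aeval env (AVar (@Ordinal 4 3 isT)) = Some k by [].
have ec m : aeval env (AConst 4 m) = Some m by [].
have ea := aeval_mod eA ep p0; have eb := aeval_mod eB ep p0.
have e2 := aeval_exp ep (ec 2); have eX := aeval_exp (ec 2) e2.
have X0 : 0 < 2 ^ p ^ 2 by rewrite expn_gt0.
have Y0 : 0 < 2 ^ (p ^ 2 * (p - 1)) by rewrite expn_gt0.
have er := aeval_mod (aeval_mod (aeval_div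
  (aeval_exp (aeval_add (aeval_add (aeval_exp (ec 2) (aeval_mul (ec 3) e2)) (aeval_mul ea eX)) eb)
     (aeval_div ep (ec 2) isT))
  (aeval_exp (ec 2) (aeval_mul e2 (aeval_sub ep (ec 1)))) Y0) eX X0) ep p0.
set r := _ %% p in er *.
have rp : r < p by rewrite ltn_mod.
have ei := aeval_sub (ec 1) (aeval_sub (aeval_add (aeval_mul (ec 4) ep) (ec 1)) (aeval_exp er (ec 2))).
set i := 1 - _ in ei *.
have eap := aeval_mul er (aeval_sub (ec 1) ei).
have eam := aeval_mul ei (aeval_sub ep er).
set ap := r * _ in eap *; set am := i * _ in eam *.
have eu := aeval_exp (ec 2) (aeval_mul (aeval_add ek (ec 1)) ep).
have pu : p < 2 ^ ((k + 1) * p).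
  by apply: leq_trans (ltn_expl p (isT : 1 < 2)) _; rewrite leq_exp2l // leq_pmull // addn1.
have app : ap <= p.
  by apply: (leq_trans _ (ltnW rp)); rewrite /ap -{2}[r]muln1 leq_mul2l leq_subr orbT.
set u := 2 ^ _ in eu pu *.
have eu2 := aeval_exp eu (ec 2).
have eQ := aeval_mul (aeval_sub (aeval_add (aeval_add eu2 (aeval_mul eam eu)) ep) (aeval_mul eap eu))
  (aeval_sub eu ep).
set Q := (_ - _) * (_ - _) in eQ *.
have Q0 : 0 < Q.
  rewrite /Q muln_gt0 !subn_gt0 pu andbT -addnA ltn_addr // -mulnn ltn_pmul2r.
    exact: leq_ltn_trans app pu.
  exact: leq_ltn_trans pu.
have eP := aeval_sub
  (aeval_add (aeval_add (aeval_mul (ec 4) eu2) (aeval_mul (aeval_mul (ec 3) eam) eu))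
     (aeval_mul ep (aeval_add eap (ec 2))))
  (aeval_add (aeval_mul (aeval_add (aeval_mul (ec 3) eap) (aeval_mul (ec 2) ep)) eu)
     (aeval_mul ep eam)).
have eF := aeval_div (aeval_mul (aeval_exp eu (aeval_add ek (ec 1))) eP) eQ Q0.
have u0 : 0 < u by exact: leq_ltn_trans pu.
exact: aeval_sub (aeval_mul (ec 3) (aeval_exp ep ek)) (aeval_mod eF eu u0).
Qed.

Theorem theorem8 :
  (forall (p k A B : nat) (K : finFieldType),
     prime p -> 17 <= p -> 1 <= k ->
     4 * (A %% p) ^ 3 + 27 * (B %% p) ^ 2 <> 0 %[mod p] ->
     #|K| = p ^ k ->
     #|@affine_points K (A %% p)%:R%R (B %% p)%:R%R| = count_formula A B p k)
  /\
  (exists t : aterm 4,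
     forall p k A B : nat,
       prime p -> 17 <= p -> 1 <= k ->
       4 * (A %% p) ^ 3 + 27 * (B %% p) ^ 2 <> 0 %[mod p] ->
       aeval [tuple A; B; p; k] t = Some (count_formula A B p k)).
Proof.
split; first exact: card_affine_points_formula.
by exists count_term => p k A B p_pr _ _ _; apply: aeval_count_term; apply: prime_gt0.
Qed.
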